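(* Let $f:S^1\to S^1$ be a multicritical circle map without periodic points, let $c_0$ be one of its critical points, and let $\mathcal{P}_n=\mathcal{P}_n(c_0)$ be the $n$-th dynamical partition of $f$ associated with $c_0$. There exists a constant $C>1$, depending only on $f$, such that for all $n\ge 0$ and for each pair of adjacent atoms $I,J\in\mathcal{P}_n$, $$C^{-1}|J|\le |I|\le C|J|.$$
   Context: $S^1=\mathbb{R}/\mathbb{Z}$; $|I|$ is the length of an interval $I\subset S^1$. A multicritical circle map is an orientation-preserving homeomorphism $f:S^1\to S^1$ of class $C^r$, $r\ge 3$, having finitely many critical points $c_0,\dots,c_{N-1}$, $N\ge 1$, such that there exist (open) neighbourhoods $W_i\subseteq S^1$ of $c_i$ ($0\le i\le N-1$) with: (1) $f$ has negative Schwarzian derivative on $W_i\setminus\{c_i\}$; (2) there exist constants $0<\alpha_i<\beta_i$ and $s_i>1$ such that $\alpha_i|x-c_i|^{s_i-1}<f'(x)<\beta_i|x-c_i|^{s_i-1}$ for all $x\in W_i\setminus\{c_i\}$; (3) the variation of $\log f'$ on $S^1\setminus\bigcup_i W_i$ is finite. Since $f$ has no periodic points, its rotation number $\rho\in(0,1)$ is irrational; write $\rho=[a_0,a_1,\dots]=\cfrac{1}{a_0+\cfrac{1}{a_1+\cdots}}$ and $q_0=1$, $q_1=a_0$, $q_{n+1}=a_nq_n+q_{n-1}$ for $n\ge1$. For $x\in S^1$, $I_n(x)$ is the closed interval with endpoints $x$ and $f^{q_n}(x)$ that contains $f^{q_{n+2}}(x)$. The $n$-th dynamical partition associated with $x$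 is $$\mathcal{P}_n(x)=\{f^i(I_n(x)):0\le i\le q_{n+1}-1\}\cup\{f^j(I_{n+1}(x)):0\le j\le q_n-1\},$$ a partition of $S^1$ modulo endpoints. Its elements are called atoms; two atoms are adjacent if they share an endpoint. *)

(* Defs.v *)
From mathcomp Require Import all_boot all_order all_algebra.
From mathcomp Require Import all_classical all_reals all_analysis.

Set Implicit Arguments.
Unset Strict Implicit.
Unset Printing Implicit Defensive.

Import Order.TTheory GRing.Theory Num.Theory.
Import numFieldNormedType.Exports.

Local Open Scope classical_set_scope.
Local Open Scope quotient_scope.
Local Open Scope ring_scope.

Section Circle.
Variable R : realType.

Definition eqmod1 : rel R := fun x y => x - y \is a Num.int.

Lemma eqmod1_equiv : equiv_class_of eqmod1.
Proof.
split=> [x|x y|y x z]; rewrite /eqmod1.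
- by rewrite subrr rpred0.
- by rewrite -opprB rpredN.
- by move=> xy yz; rewrite -(subrKA y) rpredD.
Qed.

Canonical eqmod1_equivRel := EquivRelPack eqmod1_equiv.

Definition circle := quotient_topology {eq_quot eqmod1_equivRel}.

Definition circle_proj (x : R) : circle := \pi_circle x.

Definition frac_part (x : R) : R := x - (Num.floor x)%:~R.

Definition circle_dist (x y : circle) : R :=
  let d := frac_part (repr x - repr y) in Num.min d (1 - d).

(* the closed arc run through from x to y in the positive direction *)
Definition circle_arc (x y : circle) : set circle :=
  circle_proj @` `[repr x, repr x + frac_part (repr y - repr x)]%classic.

Definition arc_endpoint (A : set circle) (x : circle) : Prop :=
  exists a b : R, [/\ a <= b, b < a + 1, A = circle_proj @` `[a, b]%classic &
                     x = circle_proj a \/ x = circle_proj b].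

Definition arc_length (A : set circle) : R :=
  fine (lebesgue_measure (`[0, 1[%classic `&` circle_proj @^-1` A)).

(* Total variation of g along A: partition points lie in A and are listed in
   cyclic order, going around the circle at most once. *)
Definition finite_variation (A : set circle) (g : circle -> R) : Prop :=
  exists M : R, forall (m : nat) (t : nat -> R),
    (forall i, (i < m)%N -> t i <= t i.+1) -> t m <= t 0%N + 1 ->
    (forall i, (i <= m)%N -> A (circle_proj (t i))) ->
    \sum_(i < m) `|g (circle_proj (t i.+1)) - g (circle_proj (t i))| <= M.

Definition homeomorphism (f : circle -> circle) : Prop :=
  continuous f /\
  exists g : circle -> circle, [/\ continuous g, cancel f g & cancel g f].

Definition is_lift (f : circle -> circle) (F : R -> R) : Prop :=
  continuous F /\ forall x, circle_proj (F x) = f (circle_proj x).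

Definition orientation_preserving (f : circle -> circle) : Prop :=
  exists F, is_lift f F /\ {homo F : x y / x < y}.

(* Two lifts of f differ by an integer constant, so neither the derivatives of
   f nor its rotation number modulo 1 depend on the lift chosen here. *)
Definition circle_lift (f : circle -> circle) : R -> R :=
  xget (idfun : R -> R) [set F : R -> R | is_lift f F].

Definition class_C (r : nat) (f : circle -> circle) : Prop :=
  (forall k, (k < r)%N ->
     forall x, derivable (derive1n k (circle_lift f)) x 1) /\
  continuous (derive1n r (circle_lift f)).

(* For degree one f the derivatives of the lift are 1-periodic, hence the
   choice of the representative of x is immaterial. *)
Definition circle_deriv (n : nat) (f : circle -> circle) (x : circle) : R :=
  derive1n n (circle_lift f) (repr x).

Definition schwarzian (f : circle -> circle) (x : circle) : R :=
  circle_deriv 3 f x / circle_deriv 1 f x -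
  3 / 2 * (circle_deriv 2 f x / circle_deriv 1 f x) ^+ 2.

Definition critical_point (f : circle -> circle) (x : circle) : Prop :=
  circle_deriv 1 f x = 0.

Definition multicritical (f : circle -> circle) : Prop :=
  [/\ homeomorphism f,
      orientation_preserving f,
      exists r : nat, (3 <= r)%N /\ class_C r f &
      exists (N : nat) (c : 'I_N -> circle) (W : 'I_N -> set circle),
        [/\ (0 < N)%N, injective c,
            forall x, critical_point f x <-> exists i, x = c i,
            forall i, open (W i) /\ W i (c i) &
            [/\ forall i x, W i x -> x <> c i -> schwarzian f x < 0,
                forall i, exists alpha beta s : R,
                  [/\ 0 < alpha, alpha < beta, 1 < s &
                    forall x, W i x -> x <> c i ->
                      alpha * circle_dist x (c i) `^ (s - 1)
                        < circle_deriv 1 f x /\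
                      circle_deriv 1 f x
                        < beta * circle_dist x (c i) `^ (s - 1)] &
                finite_variation (~` \bigcup_i W i)
                                 (fun x => ln (circle_deriv 1 f x))]]].

Definition no_periodic_points (f : circle -> circle) : Prop :=
  forall (x : circle) (n : nat), (0 < n)%N -> iter n f x <> x.

Definition rotation_number (f : circle -> circle) : R :=
  frac_part (lim ((fun n : nat => iter n (circle_lift f) 0 / n%:R) @ \oo)).

(* digits of rho = 1 / (a_0 + 1 / (a_1 + ...)), via the Gauss map *)
Definition gauss (x : R) : R := frac_part x^-1.

Definition cf_digit (rho : R) (n : nat) : nat :=
  Num.truncn (iter n gauss rho)^-1.

Fixpoint cf_denom (rho : R) (n : nat) : nat :=
  match n with
  | 0 => 1%N
  | n'.+1 =>
    match n' with
    | 0 => cf_digit rho 0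
    | n''.+1 => (cf_digit rho n' * cf_denom rho n' + cf_denom rho n'')%N
    end
  end.

Definition return_time (f : circle -> circle) (n : nat) : nat :=
  cf_denom (rotation_number f) n.

Definition dyn_interval (f : circle -> circle) (n : nat) (x : circle) :
    set circle :=
  let y := iter (return_time f n) f x in
  let z := iter (return_time f n.+2) f x in
  if `[< circle_arc x y z >] then circle_arc x y else circle_arc y x.

Definition dyn_partition (f : circle -> circle) (n : nat) (x : circle) :
    set (set circle) :=
  [set iter i f @` dyn_interval f n x | i in `I_(return_time f n.+1)] `|`
  [set iter j f @` dyn_interval f n.+1 x | j in `I_(return_time f n)].

Definition adjacent_atoms (I J : set circle) : Prop :=
  exists x, arc_endpoint I x /\ arc_endpoint J x.

End Circle.

(* Main.v *)
(* A lift F of f satisfies a cross ratio inequality: for a < b < c < d the number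
   (b - a)(d - c) / ((c - a)(d - b)) is multiplied by F by at most
   exp (Phi d - Phi a), where Phi is nondecreasing and Phi (x + 1) = Phi x + P.
   Indeed F' (x) (v - u) <= B (F v - F u) for u <= x <= v, because of the power
   laws; log F' is Lipschitz away from the critical points; and near a critical
   point, on an interval avoiding it, the negative Schwarzian derivative makes
   the cross ratio decrease.  So Phi has to count lengths and critical points
   only.  Along q_(n+1) iterates of an interval consisting of boundedly many
   fundamental domains of g = F^(q_n) - p_n the factors have a bounded product,
   since these iterates cover the circle boundedly often.
     Bounded geometry of g: at a point where g - id is extremal the cross ratio
   of three adjacent fundamental domains is bounded below; since every orbit
   visits a given fundamental domain before time q_n + q_(n+1), the inequality
   transports this lower bound to every point of the circle, so that
   |g x - x| and |g (g x) - g x| are comparable for all x.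
     Comparison of two successive levels at a critical point c: a small quotient
   eps = |I_(n+1)(c)| / |I_n(c)| becomes much smaller after one iterate, but it
   is of order eps again after 2 q_(n+1) iterates, so eps is bounded below by the
   cross ratio inequality, first at c and then along the whole partition.
     Without periodic points, two atoms share an end point only if they have an
   iterate f^a (c) as a common end point with the same exponent a, which reduces
   the theorem to these two comparisons. *)

Require Import Defs.
From mathcomp Require Import all_boot all_order all_algebra.
From mathcomp Require Import all_classical all_reals all_analysis.
From mathcomp Require Import ring lra zify.

Set Implicit Arguments.
Unset Strict Implicit.
Unset Printing Implicit Defensive.

Import Order.TTheory GRing.Theory Num.Theory.
Import numFieldNormedType.Exports.

Local Open Scope classical_set_scope.
Local Open Scope ring_scope.

(** * Negative Schwarzian derivative and cross ratios *)

Section RealDerivatives.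
Variable R : realType.
Implicit Types (f g : R -> R) (x a b : R).

Lemma is_derive_congr f x a b : is_derive x 1 f a -> a = b -> is_derive x 1 f b.
Proof. by move=> fa <-. Qed.

Lemma is_derive_add f g x a b : is_derive x 1 f a -> is_derive x 1 g b ->
  is_derive x 1 (fun t => f t + g t) (a + b).
Proof. by move=> fa gb; exact: is_deriveD. Qed.

Lemma is_derive_sub f g x a b : is_derive x 1 f a -> is_derive x 1 g b ->
  is_derive x 1 (fun t => f t - g t) (a - b).
Proof. by move=> fa gb; exact: is_deriveB. Qed.

Lemma is_derive_mul f g x a b : is_derive x 1 f a -> is_derive x 1 g b ->
  is_derive x 1 (fun t => f t * g t) (a * g x + f x * b).
Proof.
move=> fa gb; apply: is_derive_congr (is_deriveM fa gb) _.
by rewrite /GRing.scale /= addrC (mulrC a).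
Qed.

Lemma is_derive_const x a : is_derive x 1 (fun=> a) 0.
Proof. exact: is_derive_cst. Qed.

Lemma is_derive_idfun x : is_derive x 1 (fun t : R => t) 1.
Proof. exact: is_derive_id. Qed.

Lemma is_derive_inv f x a : is_derive x 1 f a -> f x != 0 ->
  is_derive x 1 (fun t => (f t)^-1) (- a / f x ^+ 2).
Proof.
move=> fa fx0; apply: is_derive_congr (is_deriveV fx0 fa) _.
by rewrite /GRing.scale /= mulrC mulrN mulNr.
Qed.

Lemma is_derive_comp_expR f x a : is_derive x 1 f a ->
  is_derive x 1 (fun t => expR (f t)) (expR (f x) * a).
Proof. by move=> fa; apply: (@is_derive1_comp _ expR f). Qed.

Lemma is_derive_comp_ln f x a : is_derive x 1 f a -> 0 < f x ->
  is_derive x 1 (fun t => ln (f t)) (a / f x).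
Proof.
move=> fa fx0; rewrite mulrC; apply: (@is_derive1_comp _ (@ln R) f) => //.
exact: is_derive1_ln.
Qed.

Lemma is_derive_continuous f x a : is_derive x 1 f a -> {for x, continuous f}.
Proof. by case=> df _; apply/differentiable_continuous/derivable1_diffP. Qed.

Lemma is_derive_MVT f f' a b : a < b ->
  (forall x, a <= x <= b -> is_derive x 1 f (f' x)) ->
  exists2 c, a < c < b & f b - f a = f' c * (b - a).
Proof.
move=> ab df.
have df' x : x \in `]a, b[ -> is_derive x 1 f (f' x).
  by rewrite in_itv/= => xab; apply: df; lra.
have cf : {within `[a, b], continuous f}.
  apply: continuous_in_subspaceT => x; rewrite inE/= in_itv/= => xab.
  exact: is_derive_continuous (df x xab).
have [c] := MVT ab df' cf; rewrite in_itv/= => cab fc.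
by exists c.
Qed.

Lemma is_derive_ge0_le f f' a b : a <= b ->
  (forall x, a <= x <= b -> is_derive x 1 f (f' x)) ->
  (forall x, a <= x <= b -> 0 <= f' x) -> f a <= f b.
Proof.
rewrite le_eqVlt => /predU1P[->//|ab] df f'0.
have [c cab e] := is_derive_MVT ab df.
rewrite -subr_ge0 e; apply: mulr_ge0; last by lra.
by apply: f'0; lra.
Qed.

Lemma is_derive_periodic f f' k a : (forall x, is_derive x 1 f (f' x)) ->
  (forall x, f (x + k) = f x + a) -> forall x, f' (x + k) = f' x.
Proof.
move=> df fk x.
have dl : is_derive x 1 (fun t => f (t + k)) (f' (x + k)).
  have dg := is_derive_add (is_derive_idfun x) (is_derive_const x k).
  have := @is_derive1_comp _ f (fun t => t + k) x _ _ (df _) dg.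
  by move=> /is_derive_congr; apply; rewrite addr0 mulr1.
have dr : is_derive x 1 (fun t => f (t + k)) (f' x).
  have -> : (fun t => f (t + k)) = (fun t => f t + a) by apply/funext.
  apply: is_derive_congr (is_derive_add (df x) (is_derive_const x a)) _.
  by rewrite addr0.
by case: dl => _ <-; case: dr.
Qed.

End RealDerivatives.

Section NegativeSchwarzian.
Variables (R : realType) (F F1 F2 F3 : R -> R) (a d : R).
Hypothesis dF : forall x : R, is_derive x 1 F (F1 x).
Hypothesis dF1 : forall x : R, is_derive x 1 F1 (F2 x).
Hypothesis dF2 : forall x : R, is_derive x 1 F2 (F3 x).
Hypothesis F1_gt0 : forall x, a <= x <= d -> 0 < F1 x.
Hypothesis F_schwarzian : forall x, a <= x <= d ->
  F3 x / F1 x - 3 / 2 * (F2 x / F1 x) ^+ 2 <= 0.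

Let F_lt x y : a <= x -> x < y -> y <= d -> F x < F y.
Proof.
move=> ax xy yd; rewrite -subr_gt0.
have [t txy ->] := is_derive_MVT xy (fun t _ => dF t).
by rewrite mulr_gt0 ?subr_gt0//; apply: F1_gt0; lra.
Qed.

Let F_le x y : a <= x -> x <= y -> y <= d -> F x <= F y.
Proof.
move=> ax; rewrite le_eqVlt => /predU1P[->//|xy] yd.
exact/ltW/F_lt.
Qed.

(** This is [F1] to the power -1/2. Where [F1 > 0], its second derivative is -1/2 times the
    Schwarzian derivative of [F] times [h]. *)
Let h t := expR (- (ln (F1 t) / 2)).

Let hh t : a <= t <= d -> h t * h t * F1 t = 1.
Proof.
move=> /F1_gt0 F1t; rewrite /h -expRD.
have -> : - (ln (F1 t) / 2) - ln (F1 t) / 2 = - ln (F1 t) by field.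
by rewrite expRN lnK ?posrE// mulVf ?gt_eqF.
Qed.

Let dh t : a <= t <= d -> is_derive t 1 h (- (F2 t / F1 t / 2) * h t).
Proof.
move=> /F1_gt0 F1t; rewrite /h.
have := is_derive_comp_expR (is_derive_sub (is_derive_const t 0)
  (is_derive_mul (is_derive_comp_ln (dF1 t) F1t) (is_derive_const t 2^-1))).
rewrite sub0r; under eq_fun do rewrite sub0r.
by move=> /is_derive_congr; apply; ring.
Qed.

(* [F' ^ (-1/2)] is convex, so [t |-> h x * h t * (F t - F x)] is convex and
   lies above its tangent [t - x] at [x]. *)
Lemma schwarzian_slope_le x y : a <= x -> x <= y -> y <= d ->
  (y - x) ^+ 2 * (F1 x * F1 y) <= (F y - F x) ^+ 2.
Proof.
move=> ax xy yd.
pose k' t := h x * (- (F2 t / F1 t / 2) * h t * (F t - F x) + h t * F1 t) - 1.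
have dk t : a <= t <= d ->
    is_derive t 1 (fun t => h x * (h t * (F t - F x)) - (t - x)) (k' t).
  move=> tad.
  have := is_derive_sub (is_derive_mul (is_derive_const t (h x))
    (is_derive_mul (dh tad) (is_derive_sub (dF t) (is_derive_const t (F x)))))
    (is_derive_sub (is_derive_idfun t) (is_derive_const t x)).
  by move=> /is_derive_congr; apply; rewrite /k'; ring.
(* In the second derivative of [h t * (F t - F x)] the terms coming from [2 * h' * F1] and [h * F2]
   cancel, which leaves the Schwarzian derivative only. *)
pose k'' t := h x * h t * (F t - F x) *
  (- 2^-1 * (F3 t / F1 t - 3 / 2 * (F2 t / F1 t) ^+ 2)).
have dk' t : a <= t <= d -> is_derive t 1 k' (k'' t).
  move=> tad; have F1t := F1_gt0 tad.
  have F1t0 : F1 t != 0 by rewrite gt_eqF.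
  have dN := is_derive_mul (dF2 t) (is_derive_inv (dF1 t) F1t0).
  have dhalf := is_derive_sub (is_derive_const t 0)
    (is_derive_mul dN (is_derive_const t 2^-1)).
  have := is_derive_sub (is_derive_mul (is_derive_const t (h x)) (is_derive_add
    (is_derive_mul (is_derive_mul dhalf (dh tad))
       (is_derive_sub (dF t) (is_derive_const t (F x))))
    (is_derive_mul (dh tad) (dF1 t)))) (is_derive_const t 1).
  have -> : (fun t => h x * ((0 - F2 t * (F1 t)^-1 * 2^-1) * h t * (F t - F x) +
      h t * F1 t) - 1) = k' by apply/funext => u; rewrite /k' sub0r.
  by move=> /is_derive_congr; apply; rewrite /k''; field.
have k'x : k' x = 0.
  by rewrite /k' subrr mulr0 add0r mulrA hh ?subrr//; lra.
have k'_ge0 t : x <= t <= y -> 0 <= k' t.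
  move=> txy; rewrite -k'x.
  have xt : x <= t by lra.
  have sub u : x <= u <= t -> a <= u <= d by lra.
  apply: (is_derive_ge0_le xt (fun u ut => dk' u (sub u ut))) => u ut.
  have uad := sub u ut.
  apply: mulr_ge0; last by have := F_schwarzian uad; lra.
  apply: mulr_ge0; first by rewrite mulr_ge0 ?expR_ge0.
  by rewrite subr_ge0 F_le//; lra.
have dkxy t : x <= t <= y ->
    is_derive t 1 (fun t => h x * (h t * (F t - F x)) - (t - x)) (k' t).
  by move=> txy; apply: dk; lra.
have := is_derive_ge0_le xy dkxy k'_ge0.
rewrite !subrr !mulr0 subrr subr_ge0 => kxy.
have hx : h x * h x * F1 x = 1 by apply: hh; lra.
have hy : h y * h y * F1 y = 1 by apply: hh; lra.
have -> : (F y - F x) ^+ 2 =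
    (h x * (h y * (F y - F x))) ^+ 2 * (F1 x * F1 y).
  transitivity ((F y - F x) ^+ 2 * (h x * h x * F1 x) * (h y * h y * F1 y)).
    by rewrite hx hy !mulr1.
  by ring.
apply: ler_wpM2r; first by rewrite mulr_ge0// ltW// F1_gt0//; lra.
by rewrite ler_sqr// nnegrE; lra.
Qed.

(** [schwarzian_slope_le] gives the sign of the mixed second derivative of
    [ln ((F y - F x) / (y - x))]. Here [- E x y] is the derivative of this function in [x];
    integrating in [y] from [c] to [d] and then in [x] from [a] to [b] gives the inequality. *)
Lemma schwarzian_cross_ratio b c : a < b -> b < c -> c < d ->
  (F b - F a) * (F d - F c) * ((c - a) * (d - b)) <=
  (b - a) * (d - c) * ((F c - F a) * (F d - F b)).
Proof.
move=> ab bc cd.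
pose E x y := F1 x / (F y - F x) - (y - x)^-1.
have E_le x : a <= x -> x <= b -> E x c <= E x d.
  move=> ax xb.
  apply: (is_derive_ge0_le (ltW cd) (f' := fun y =>
     ((y - x) ^+ 2)^-1 - F1 x * F1 y / (F y - F x) ^+ 2)) => y ycd.
    have yx : y - x != 0 by rewrite subr_eq0 gt_eqF//; lra.
    have Fyx : F y - F x != 0 by rewrite subr_eq0 gt_eqF// F_lt//; lra.
    have := is_derive_sub (is_derive_mul (is_derive_const y (F1 x))
      (is_derive_inv (is_derive_sub (dF y) (is_derive_const y (F x))) Fyx))
      (is_derive_inv (is_derive_sub (is_derive_idfun y) (is_derive_const y x)) yx).
    by move=> /is_derive_congr; apply; field; rewrite yx Fyx.
  have xy : 0 < y - x by lra.
  have Fxy : 0 < F y - F x by rewrite subr_gt0 F_lt//; lra.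
  rewrite subr_ge0 ler_pdivrMr ?exprn_gt0// ler_pdivlMl ?exprn_gt0//.
  by rewrite schwarzian_slope_le//; lra.
pose Psi x := ln (F d - F x) - ln (F c - F x) - (ln (d - x) - ln (c - x)).
have Psi_le : Psi b <= Psi a.
  rewrite -lerN2 -[- Psi a]sub0r -[- Psi b]sub0r.
  apply: (is_derive_ge0_le (ltW ab) (f := fun x => 0 - Psi x)
    (f' := fun x => E x d - E x c)) => x xab; last first.
    by rewrite subr_ge0 E_le//; lra.
  have Fxc : 0 < F c - F x by rewrite subr_gt0 F_lt//; lra.
  have Fxd : 0 < F d - F x by rewrite subr_gt0 F_lt//; lra.
  have xc : 0 < c - x by lra.
  have xd : 0 < d - x by lra.
  have dl e := is_derive_sub (is_derive_const x (F e)) (dF x).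
  have di e := is_derive_sub (is_derive_const x e) (is_derive_idfun x).
  have := is_derive_sub (is_derive_const x 0) (is_derive_sub (is_derive_sub
    (is_derive_comp_ln (dl d) Fxd) (is_derive_comp_ln (dl c) Fxc))
    (is_derive_sub (is_derive_comp_ln (di d) xd) (is_derive_comp_ln (di c) xc))).
  by move=> /is_derive_congr; apply; rewrite /E; field; rewrite !gt_eqF.
have Fab : F a < F b by rewrite F_lt//; lra.
have Fbc : F b < F c by rewrite F_lt//; lra.
have Fcd : F c < F d by rewrite F_lt//; lra.
(* The complementary cross ratio [(c - b) * (d - a) / ((c - a) * (d - b))] does not decrease under
   [F]; the two cross ratios add up to 1. *)
have key : (F d - F b) * (F c - F a) * ((c - b) * (d - a)) <=
           (F d - F a) * (F c - F b) * ((d - b) * (c - a)).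
  rewrite -ler_ln ?posrE ?mulr_gt0 ?subr_gt0//; try lra.
  by rewrite !lnM ?posrE ?mulr_gt0 ?subr_gt0//; try lra;
     move: Psi_le; rewrite /Psi; lra.
move: key; lra.
Qed.

End NegativeSchwarzian.

(** * Rotation numbers and the order of orbits *)

Section CircleLiftOrder.
Variables (R : realType) (F : R -> R).
Implicit Types x y : R.
Hypothesis F_lt : forall x y, x < y -> F x < F y.
Hypothesis F_add1 : forall x, F (x + 1) = F x + 1.

Lemma iter_addz n x (k : int) : iter n F (x + k%:~R) = iter n F x + k%:~R.
Proof.
have H (m : nat) y : F (y + m%:R) = F y + m%:R.
  elim: m y => [|m IH] y; first by rewrite !addr0.
  by rewrite -natr1 !addrA F_add1 IH.
have Hz y : F (y + k%:~R) = F y + k%:~R.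
  case: k => m; first exact: H.
  rewrite NegzE rmorphN /=; apply: (addIr m.+1%:R).
  by rewrite -H !subrK.
by elim: n => //= n ->; rewrite Hz.
Qed.

Lemma iter_lt n x y : x < y -> iter n F x < iter n F y.
Proof. by elim: n => //= n IH /IH/F_lt. Qed.

Lemma iter_le n x y : x <= y -> iter n F x <= iter n F y.
Proof. by rewrite le_eqVlt => /predU1P[->//|/(iter_lt n)/ltW]. Qed.

(** The point [x] lies between two consecutive integer translates of [y], and the iterates are
    monotone and commute with these translations. *)
Lemma iter_displacement n x y :
  `|(iter n F x - x) - (iter n F y - y)| <= 1.
Proof.
have /andP[] := floor_itv (x - y); rewrite intrD1.
set k := Num.floor _ => h1 h2.
have h3 : iter n F (y + k%:~R) <= iter n F x by apply: iter_le; lra.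
have h4 : iter n F x <= iter n F (y + (k + 1)%:~R).
  by apply: iter_le; rewrite intrD1; lra.
rewrite !iter_addz intrD1 in h3 h4.
by rewrite ler_norml; lra.
Qed.

Lemma iter_mul_le m n : `|iter (m * n) F 0 - m%:R * iter n F 0| <= m%:R.
Proof.
elim: m => [|m IH]; first by rewrite mul0n mul0r subrr normr0.
rewrite mulSn addnC iterD.
have -> : iter (m * n) F (iter n F 0) - m.+1%:R * iter n F 0 =
  (iter (m * n) F (iter n F 0) - iter n F 0 - (iter (m * n) F 0 - 0)) +
  (iter (m * n) F 0 - m%:R * iter n F 0) by rewrite -natr1; ring.
apply: (le_trans (ler_normD _ _)); rewrite -natr1 addrC lerD//.
exact: iter_displacement.
Qed.

(** Computing [iter (m * n) F 0] in two ways by [iter_mul_le] shows that each [(iter n F 0 - 1) / n]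
    is at most each [(iter m F 0 + 1) / m]. The supremum of the former separates the two
    families. *)
Lemma translation_number : exists2 tau : R,
  (fun n => iter n F 0 / n%:R) @ \oo --> tau &
  forall n, `|iter n F 0 - n%:R * tau| <= 1.
Proof.
pose S := [set (iter n.+1 F 0 - 1) / n.+1%:R | n in [set: nat]].
have ub n : ubound S ((iter n.+1 F 0 + 1) / n.+1%:R).
  move=> _ [m _ <-].
  have n0 : 0 < n.+1%:R :> R by rewrite ltr0n.
  have m0 : 0 < m.+1%:R :> R by rewrite ltr0n.
  rewrite ler_pdivrMr// mulrAC ler_pdivlMr//.
  have := iter_mul_le m.+1 n.+1; rewrite mulnC => /ler_normlP[_ h1].
  have /ler_normlP[h2 _] := iter_mul_le n.+1 m.+1.
  by lra.
have S0 : S !=set0 by exists ((iter 1 F 0 - 1) / 1%:R), 0%N.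
have Sub : has_ubound S by exists ((iter 1 F 0 + 1) / 1%:R); exact: ub 0%N.
have bnd n : `|iter n F 0 - n%:R * sup S| <= 1.
  case: n => [|n]; first by rewrite /= mul0r subrr normr0.
  have n0 : 0 < n.+1%:R :> R by rewrite ltr0n.
  have h1 : (iter n.+1 F 0 - 1) / n.+1%:R <= sup S.
    by apply: ub_le_sup => //; exists n.
  have h2 : sup S <= (iter n.+1 F 0 + 1) / n.+1%:R by apply: ge_sup.
  rewrite ler_pdivrMr// in h1; rewrite ler_pdivlMr// in h2.
  by rewrite ler_norml; lra.
exists (sup S) => //.
apply/cvgrPdist_lt => e e0; near=> n.
have n0 : 0 < n%:R :> R by rewrite ltr0n; near: n; exact: nbhs_infty_gt.
have en : e^-1 < n%:R by near: n; exact: nbhs_infty_gtr.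
have -> : sup S - iter n F 0 / n%:R = - (iter n F 0 - n%:R * sup S) / n%:R.
  by field; rewrite gt_eqF.
rewrite normrM normrN normfV (gtr0_norm n0) ltr_pdivrMr//.
by apply: (le_lt_trans (bnd n)); rewrite -ltr_pdivrMl// mulr1.
Unshelve. all: by end_near.
Qed.

End CircleLiftOrder.

Section OrderOfOrbits.
Variables (R : realType).
Implicit Types x y z tau : R.

(** The number [tau] is specified by a uniform bound instead of a limit, a form that survives
    conjugation by [x |-> - x] and is what the order arguments consume. *)
Record circle_lift_map (F : R -> R) (tau : R) : Prop := CircleLiftMap {
  clm_lt : forall x y, x < y -> F x < F y;
  clm_add1 : forall x, F (x + 1) = F x + 1;
  clm_continuous : continuous F;
  clm_aperiodic : forall x n (k : int), (0 < n)%N -> iter n F x <> x + k%:~R;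
  clm_translation : forall n, `|iter n F 0 - n%:R * tau| <= 1 }.

Lemma clm_opp F tau : circle_lift_map F tau ->
  circle_lift_map (fun x => - F (- x)) (- tau).
Proof.
move=> [Flt Fadd Fc Fap Ftr].
have iterN n x : iter n (fun x => - F (- x)) x = - iter n F (- x).
  by elim: n => [|n /= ->]; rewrite ?opprK.
split.
- by move=> x y xy; rewrite ltrN2 Flt// ltrN2.
- by move=> x; have := Fadd (- x - 1); rewrite subrK => ->; rewrite !opprD subrK.
- move=> x; apply: continuousN; apply: continuous_comp; first exact: opp_continuous.
  exact: Fc.
- move=> x n k n0 e; apply: (Fap (- x) n (- k) n0).
  by rewrite rmorphN/= -opprD -e iterN opprK.
- by move=> n; rewrite iterN oppr0 mulrN opprK -normrN opprD opprK addrC addrC.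
Qed.

Section Fixed.
Variables (F : R -> R) (tau : R).
Hypothesis CF : circle_lift_map F tau.
Let F_lt := clm_lt CF.
Let F_add1 := clm_add1 CF.

Lemma iter_continuous n : continuous (iter n F).
Proof.
elim: n => [|n IH] x /=; first exact: cvg_id.
by apply: continuous_comp; [exact: IH|exact: (clm_continuous CF)].
Qed.

Lemma clm_surjective n y : exists x, iter n F x = y.
Proof.
pose k := (Num.floor (y - iter n F 0)).
have /andP[] := floor_itv (y - iter n F 0); rewrite intrD1 -/k => h1 h2.
have ec (j : int) : iter n F j%:~R = iter n F 0 + j%:~R.
  by rewrite -(iter_addz F_add1) add0r.
have kk : k%:~R <= (k + 1)%:~R :> R by rewrite ler_int; lia.
have yk : Num.min (iter n F k%:~R) (iter n F (k + 1)%:~R) <= y <=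
          Num.max (iter n F k%:~R) (iter n F (k + 1)%:~R).
  rewrite !ec ge_min le_max intrD1.
  by apply/andP; split; apply/orP; [left|right]; lra.
have [x _ e] := IVT kk (continuous_subspaceT (@iter_continuous n)) yk.
by exists x.
Qed.

(** The displacement [iter n F x - x] is continuous and, by aperiodicity, omits every integer
    value. *)
Lemma iter_displacement_sign n (k : int) : (0 < n)%N ->
  (forall x, x + k%:~R < iter n F x) \/ (forall x, iter n F x < x + k%:~R).
Proof.
move=> n0; have [h|/existsNP[x hx]] := pselect (forall x, x + k%:~R < iter n F x).
  by left.
right => y; rewrite ltNge; apply/negP => hy.
move/negP : hx; rewrite -leNgt => hx.
pose f t := iter n F t - t.
have cf : continuous f.
  by move=> t; apply: cvgB; [exact: iter_continuous|exact: cvg_id].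
suff [t e] : exists t, f t = k%:~R.
  by apply: (clm_aperiodic CF (x := t) (k := k) n0); rewrite -e /f; ring.
have fx : f x <= k%:~R by rewrite /f; lra.
have fy : k%:~R <= f y by rewrite /f; lra.
have [xy|/ltW yx] := leP x y.
  have kxy : Num.min (f x) (f y) <= k%:~R <= Num.max (f x) (f y).
    by rewrite ge_min le_max fx fy orbT.
  by have [t _ e] := IVT xy (continuous_subspaceT cf) kxy; exists t.
have kxy : Num.min (f y) (f x) <= k%:~R <= Num.max (f y) (f x).
  by rewrite ge_min le_max fx fy orbT.
by have [t _ e] := IVT yx (continuous_subspaceT cf) kxy; exists t.
Qed.

(** By periodicity the displacement has a minimum, which exceeds [k]; iterating shows that the mean
    displacement [n * tau] is no smaller than this minimum. *)
Lemma displacement_translation n (k : int) : (0 < n)%N ->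
  (forall x, x + k%:~R < iter n F x) -> k%:~R < n%:R * tau.
Proof.
move=> n0 h; pose f t := iter n F t - t.
have cf : {within `[0, 1], continuous f}.
  apply: continuous_subspaceT => t.
  by apply: cvgB; [exact: iter_continuous|exact: cvg_id].
have [c _ Hc] := EVT_min ler01 cf.
have fck : k%:~R < f c by rewrite /f; have := h c; lra.
have fmin x : x + f c <= iter n F x.
  have := Hc (x - (Num.floor x)%:~R).
  rewrite in_itv/=; have /andP[] := floor_itv x; rewrite intrD1 => fl1 fl2.
  rewrite [f (x - _)]/f -rmorphN/= (iter_addz F_add1) rmorphN/=.
  by move=> /(_ ltac:(lra)); lra.
have fj j : j%:R * f c <= iter (j * n) F 0.
  elim: j => [|j IH]; first by rewrite mul0r.
  rewrite mulSn iterD -natr1 mulrDl mul1r.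
  by apply: le_trans (fmin _); rewrite lerD2r.
apply: (lt_le_trans fck); rewrite leNgt; apply/negP => ntau.
pose e := f c - n%:R * tau.
have e0 : 0 < e by rewrite /e; lra.
(* Since [j * e > 1], the point [iter (j * n) F 0] would exceed [j * n * tau] by more than the
   allowed 1. *)
pose j := (Num.truncn (e^-1)).+1.
have je : e^-1 < j%:R.
  have ei0 : 0 < e^-1 by rewrite invr_gt0.
  by have /andP[] := truncn_itv (ltW ei0).
have : 1 < j%:R * e by rewrite mulrC -ltr_pdivrMl// mulr1.
have := clm_translation CF (j * n); rewrite ler_norml natrM => /andP[_ h2].
by have := fj j; rewrite /e; lra.
Qed.

End Fixed.

Lemma translation_displacement F tau n (k : int) : circle_lift_map F tau ->
  (0 < n)%N -> k%:~R <= n%:R * tau -> forall x, x + k%:~R < iter n F x.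
Proof.
move=> CF n0 h; have [//|H] := iter_displacement_sign CF k n0.
have iterN m x : iter m (fun x => - F (- x)) x = - iter m F (- x).
  by elim: m => [|m /= ->]; rewrite ?opprK.
have : (- k)%:~R < n%:R * - tau.
  apply: (displacement_translation (clm_opp CF) n0) => x.
  by rewrite iterN rmorphN/=; have := H (- x); lra.
by rewrite rmorphN/=; lra.
Qed.

Lemma translation_irrational F tau n (k : int) : circle_lift_map F tau ->
  (0 < n)%N -> n%:R * tau != k%:~R.
Proof.
move=> CF n0; apply/eqP => e.
have := displacement_translation CF n0 (translation_displacement CF n0 _).
by move=> /(_ k); rewrite e lexx ltxx => /(_ isT).
Qed.

(** Orbits are ordered as for the translation by [tau]: after cancelling the smaller number of
    iterates, only the sign of one displacement is in question. *)
Lemma orbit_lt F tau i j (k l : int) x : circle_lift_map F tau ->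
  i%:R * tau + k%:~R < j%:R * tau + l%:~R ->
  iter i F x + k%:~R < iter j F x + l%:~R.
Proof.
move=> CF h; have [ij|ji|ij] := ltngtP i j.
- have n0 : (0 < j - i)%N by rewrite subn_gt0.
  rewrite -(subnK (ltnW ij)) iterD.
  have H := translation_displacement (k := k - l) CF n0 _ (iter i F x).
  rewrite rmorphB/= natrB ?(ltnW ij)// in H.
  by have := H ltac:(lra); lra.
- have n0 : (0 < i - j)%N by rewrite subn_gt0.
  have [H|H] := iter_displacement_sign CF (l - k) n0.
    have := displacement_translation CF n0 H.
    by rewrite rmorphB/= natrB ?(ltnW ji)//; lra.
  rewrite -(subnK (ltnW ji)) iterD.
  by have := H (iter j F x); rewrite rmorphB/=; lra.
- by rewrite ij in h *; lra.
Qed.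

Lemma orbit_le F tau i j (k l : int) x : circle_lift_map F tau ->
  i%:R * tau + k%:~R <= j%:R * tau + l%:~R ->
  iter i F x + k%:~R <= iter j F x + l%:~R.
Proof.
move=> CF; rewrite le_eqVlt => /orP[/eqP e|/orbit_lt h]; last exact/ltW/(h F).
have [ij|ji|ij] := ltngtP i j.
- have n0 : (0 < j - i)%N by rewrite subn_gt0.
  have /eqP[] := translation_irrational (k - l) CF n0.
  by rewrite rmorphB/= natrB ?(ltnW ij)//; lra.
- have n0 : (0 < i - j)%N by rewrite subn_gt0.
  have /eqP[] := translation_irrational (l - k) CF n0.
  by rewrite rmorphB/= natrB ?(ltnW ji)//; lra.
- by rewrite ij in e *; lra.
Qed.

End OrderOfOrbits.

(** * Maps with power law critical points *)

Section CompactnessOnTheLine.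
Variable R : realType.

Lemma continuous_at_le (f : R -> R) (x e : R) : {for x, continuous f} -> 0 < e ->
  exists2 dlt, 0 < dlt & forall y, `|y - x| < dlt -> `|f y - f x| < e.
Proof.
move=> cf e0; have /cvgrPdist_lt /(_ _ e0) /nbhs_ballP[dlt /= d0 H] := cf.
exists dlt => // y yx; rewrite distrC; apply: H.
by rewrite /ball/= distrC.
Qed.

(** Compactness of the segment in its filter form, with [M] running through the neighbourhoods of
    +oo. *)
Lemma unit_segment_uniform (Q : R -> R -> Prop) :
  (forall p, exists M0 dlt : R, 0 < dlt /\
     forall x M, `|x - p| < dlt -> M0 <= M -> Q M x) ->
  exists2 M : R, 1 <= M & forall x, 0 <= x <= 1 -> Q M x.
Proof.
move=> Qloc.
have /compact_near_coveringP K := @segment_compact R 0 1.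
have := K _ (pinfty_nbhs R) Q _.
case=> [p _|M [Mreal HM]].
  have [M0 [dlt [d0 H]]] := Qloc p.
  exists (ball p dlt, [set M | M0 <= M]) => /=.
    split; first exact: nbhsx_ballx.
    exact: nbhs_pinfty_ge (num_real M0).
  case=> x M /= [xp M0M]; apply: H => //.
  by rewrite distrC.
exists (Num.max M 0 + 1); first by rewrite lerDr le_max lexx orbT.
move=> x x01; apply: (HM (Num.max M 0 + 1)).
  by rewrite ltr_pwDr// le_max lexx.
by rewrite /= in_itv.
Qed.

End CompactnessOnTheLine.

Section CriticalLift.
Variables (R : realType).

(* [F1], [F2], [F3] are the successive derivatives of [F]; the exponent [s] of
   the power law is the order of the critical point minus one. *)
Record critical_lift (F F1 F2 F3 : R -> R) : Prop := CriticalLift {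
  lift_d1 : forall x : R, is_derive x 1 F (F1 x);
  lift_d2 : forall x : R, is_derive x 1 F1 (F2 x);
  lift_d3 : forall x : R, is_derive x 1 F2 (F3 x);
  lift_lt : forall x y, x < y -> F x < F y;
  lift_add1 : forall x, F (x + 1) = F x + 1;
  lift_critical : exists (N : nat) (r : 'I_N -> R),
    forall x, F1 x = 0 -> exists i, x - r i \is a Num.int;
  lift_power_law : forall c, F1 c = 0 ->
    exists dlt alpha beta s : R, [/\ 0 < dlt, 0 < alpha, 0 < beta, 0 < s &
    forall x, 0 < `|x - c| < dlt ->
      [/\ F3 x / F1 x - 3 / 2 * (F2 x / F1 x) ^+ 2 < 0,
          alpha * `|x - c| `^ s < F1 x & F1 x < beta * `|x - c| `^ s]] }.

End CriticalLift.

Section CriticalLiftTheory.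
Variables (R : realType) (F F1 F2 F3 : R -> R).
Implicit Types a b c d p t u v x y m : R.
Hypothesis FL : critical_lift F F1 F2 F3.

Let dF := lift_d1 FL.
Let dF1 := lift_d2 FL.
Let dF2 := lift_d3 FL.
Let F_lt := lift_lt FL.
Let F_add1 := lift_add1 FL.

Let F_le x y : x <= y -> F x <= F y.
Proof. by rewrite le_eqVlt => /predU1P[->//|/F_lt/ltW]. Qed.

Lemma lift_addz x (k : int) : F (x + k%:~R) = F x + k%:~R.
Proof. exact: (iter_addz F_add1 1). Qed.

Lemma lift_deriv_addz x (k : int) : F1 (x + k%:~R) = F1 x.
Proof. by apply: is_derive_periodic dF _ x => y; exact: lift_addz. Qed.

Lemma lift_deriv_ge0 x : 0 <= F1 x.
Proof.
rewrite leNgt; apply/negP => F1x.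
have F1x' : 0 < - F1 x by lra.
have [e e0 H] := continuous_at_le (is_derive_continuous (dF1 x)) F1x'.
have xe : x < x + e / 2 by lra.
have [c cx Fc] := is_derive_MVT xe (fun t _ => dF t).
have := F_lt xe; rewrite -subr_gt0 Fc pmulr_lgt0; last by lra.
have /ltr_normlP[] : `|F1 c - F1 x| < - F1 x by apply: H; rewrite gtr0_norm; lra.
by lra.
Qed.

Lemma lift_deriv_bounded : exists2 K, 0 < K & forall x, F1 x <= K.
Proof.
have cF1 : {within `[0, 1], continuous F1}.
  by apply: continuous_subspaceT => x; exact: is_derive_continuous (dF1 x).
have [c _ H] := EVT_max ler01 cF1.
exists (F1 c + 1) => [|x]; first by have := lift_deriv_ge0 c; lra.
rewrite -(lift_deriv_addz x (- Num.floor x)) rmorphN /=.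
have := H (x - (Num.floor x)%:~R).
rewrite in_itv/=; have /andP[] := floor_itv x.
by rewrite intrD1; lra.
Qed.

(** The minimum of [F (x + e) - F x] over a period is positive, and an interval of length at least
    [e] contains at least [(v - u) / (2 * e)] consecutive steps of length [e]. *)
Lemma lift_gap e : 0 < e ->
  exists2 k, 0 < k & forall u v, e <= v - u -> k * (v - u) <= F v - F u.
Proof.
move=> e0; pose f x := F (x + e) - F x.
have cf : {within `[0, 1], continuous f}.
  apply: continuous_subspaceT => x.
  have dg := is_derive_add (is_derive_idfun x) (is_derive_const x e).
  have := @is_derive1_comp _ F (fun t => t + e) x _ _ (dF _) dg.
  by move=> /is_derive_sub/(_ (dF x))/is_derive_continuous.
have [c _ Hc] := EVT_min ler01 cf.
have f0 : 0 < f c by rewrite /f subr_gt0; apply: F_lt; lra.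
have fx x : f c <= F (x + e) - F x.
  have := Hc (x - (Num.floor x)%:~R).
  rewrite in_itv/=; have /andP[] := floor_itv x; rewrite intrD1 => fl1 fl2.
  rewrite [f (x - _)]/f -rmorphN/= addrAC !lift_addz rmorphN/=.
  by move=> /(_ ltac:(lra)); lra.
have fn u n : n%:R * f c <= F (u + n%:R * e) - F u.
  elim: n => [|n IH]; first by rewrite !mul0r addr0 subrr.
  have -> : u + n.+1%:R * e = u + n%:R * e + e by rewrite -natr1; ring.
  by have := fx (u + n%:R * e); rewrite -natr1 mulrDl mul1r; lra.
exists (f c / (2 * e)); first by rewrite divr_gt0// mulr_gt0.
move=> u v uv.
have q0 : 0 <= (v - u) / e by rewrite divr_ge0; lra.
have /andP[nle ngt] := truncn_itv q0.
move: nle ngt; rewrite ler_pdivlMr// ltr_pdivrMr//.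
set n := Num.truncn _ => nle ngt.
have n1 : (1 <= n)%N.
  by rewrite lt0n; apply/eqP => n0; move: ngt; rewrite n0; lra.
have n1R : (1 : R) <= n%:R by rewrite ler1n.
have := fn u n.
have : F (u + n%:R * e) <= F v by apply: F_le; lra.
rewrite -[f c / _ * _]mulrA => Fv Fn.
suff : f c * ((2 * e)^-1 * (v - u)) <= n%:R * f c by lra.
rewrite mulrC ler_pM2r// ler_pdivrMl; last by lra.
by move: ngt; rewrite -natr1; nra.
Qed.

Lemma lift_noncritical p : F1 p != 0 -> exists dlt m M2, [/\ 0 < dlt, 0 < m, 0 <= M2 &
  forall x, `|x - p| < dlt -> [/\ m <= F1 x, F1 x <= 3 * m & `|F2 x| <= M2]].
Proof.
move=> F1p; have F1p0 : 0 < F1 p by rewrite lt_def F1p lift_deriv_ge0.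
have F1p2 : 0 < F1 p / 2 by lra.
have [d1 d10 H1] := continuous_at_le (is_derive_continuous (dF1 p)) F1p2.
have [d2 d20 H2] := continuous_at_le (is_derive_continuous (dF2 p)) ltr01.
exists (Num.min d1 d2), (F1 p / 2), (`|F2 p| + 1).
split; [by rewrite lt_min d10 d20|by []|by rewrite addr_ge0|].
move=> x; rewrite lt_min => /andP[/H1/ltr_normlP[h1 h2] /H2 h3].
split; [lra|lra|].
have := ler_normD (F2 x - F2 p) (F2 p); rewrite subrK.
by move: h3; lra.
Qed.

Section PowerLaw.
Variables (p dlt alpha beta s : R).
Hypothesis alpha_gt0 : 0 < alpha.
Hypothesis beta_gt0 : 0 < beta.
Hypothesis s_gt0 : 0 < s.
Hypothesis power_law : forall x, 0 < `|x - p| < dlt ->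
  alpha * `|x - p| `^ s < F1 x /\ F1 x < beta * `|x - p| `^ s.

Lemma power_law_le t m : F1 p = 0 -> 0 <= m -> m < dlt -> `|t - p| <= m ->
  F1 t <= beta * m `^ s.
Proof.
move=> F1p m0 md tm; have [->|tp] := eqVneq t p.
  by rewrite F1p mulr_ge0 ?powR_ge0 ?ltW.
have t0 : 0 < `|t - p| by rewrite normr_gt0 subr_eq0.
have [|_ h] := @power_law t; first by rewrite t0 (le_lt_trans tm).
apply/ltW/(lt_le_trans h); rewrite ler_pM2l//.
by apply: ge0_ler_powR; rewrite ?nnegrE// ltW.
Qed.

Lemma power_law_increment_le u v m : F1 p = 0 -> 0 <= m -> m < dlt -> u < v ->
  (forall x, u < x < v -> `|x - p| <= m) -> F v - F u <= beta * m `^ s * (v - u).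
Proof.
move=> F1p m0 md uv near; have [x xuv ->] := is_derive_MVT uv (fun t _ => dF t).
apply: ler_wpM2r; first by rewrite subr_ge0 ltW.
by apply: power_law_le => //; exact: near.
Qed.

Lemma power_law_increment_ge u v m : 0 < m -> u < v ->
  (forall x, u < x < v -> m <= `|x - p| < dlt) ->
  alpha * m `^ s * (v - u) <= F v - F u.
Proof.
move=> m0 uv far; have [x xuv ->] := is_derive_MVT uv (fun t _ => dF t).
apply: ler_wpM2r; first by rewrite subr_ge0 ltW.
have /andP[mx xd] := far x xuv.
have [|h _] := @power_law x; first by rewrite (lt_le_trans m0).
apply/(le_trans _ (ltW h)); rewrite ler_pM2l//.
by apply: ge0_ler_powR; rewrite ?nnegrE// ltW.
Qed.

(** Let [m] be the distance from [p] to the farther end of [u, v]. The quarter of [u, v] at that end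
    stays at distance at least [m / 2] from [p], so the increment over this quarter is already
    comparable with the largest possible slope times the length. *)
Lemma power_law_slope_le u v t : F1 p = 0 ->
  p - dlt < u -> u < v -> v < p + dlt -> u <= t <= v ->
  F1 t * (v - u) <= 4 * beta / (alpha * 2^-1 `^ s) * (F v - F u).
Proof.
move=> F1p pu uv vp utv.
have half0 : 0 < (2^-1 : R) `^ s by rewrite powR_gt0.
have main m w z : 0 < m -> m < dlt -> u <= w -> z <= v -> z - w = (v - u) / 4 ->
    (forall x, w < x < z -> m / 2 <= `|x - p| < dlt) -> `|t - p| <= m ->
    F1 t * (v - u) <= 4 * beta / (alpha * 2^-1 `^ s) * (F v - F u).
  move=> m0 md uw zv zw far tm.
  have h1 := power_law_le F1p (ltW m0) md tm.
  have m20 : 0 < m / 2 by rewrite divr_gt0.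
  have wz : w < z by lra.
  have := power_law_increment_ge m20 wz far.
  rewrite zw powRM ?invr_ge0 ?(ltW m0)// => h2.
  have {}h2 : alpha * (m `^ s * 2^-1 `^ s) * ((v - u) / 4) <= F v - F u.
    by apply: (le_trans h2); apply: lerB; exact: F_le.
  rewrite mulrAC ler_pdivlMr ?mulr_gt0//.
  apply: (@le_trans _ _ (beta * m `^ s * (v - u) * (alpha * 2^-1 `^ s))).
    by rewrite ler_pM2r ?mulr_gt0// ler_pM2r// subr_gt0.
  have -> : beta * m `^ s * (v - u) * (alpha * 2^-1 `^ s) =
     4 * beta * (alpha * (m `^ s * 2^-1 `^ s) * ((v - u) / 4)) by field.
  by apply: ler_wpM2l => //; rewrite mulr_ge0 ?ltW.
have [uvp|uvp] := leP (p - u) (v - p).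
  apply: (main (v - p) (v - (v - u) / 4) v); try lra.
    by move=> x xv; rewrite ger0_norm; lra.
  by rewrite ler_norml; lra.
apply: (main (p - u) u (u + (v - u) / 4)); try lra.
  by move=> x xv; rewrite ler0_norm; lra.
by rewrite ler_norml; lra.
Qed.

End PowerLaw.

(** Intervals shorter than [M^-1] are treated locally, by the power law near a critical point and by
    a derivative varying within a factor 3 elsewhere; compactness makes [M] uniform. For longer
    intervals [F1] is bounded and [lift_gap] applies. *)
Lemma lift_slope_le : exists2 B, 1 <= B &
  forall u v t, u < v -> u <= t <= v -> F1 t * (v - u) <= B * (F v - F u).
Proof.
pose Q M x := forall v t, x < v -> v < x + M^-1 -> x <= t <= v ->
  F1 t * (v - x) <= M * (F v - F x).
have [p|M M1 HQ] := @unit_segment_uniform R Q.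
  have inv_lt (e M : R) : 0 < e -> 1 + e^-1 <= M -> M^-1 < e.
    move=> e0 Me; have ei : 0 < e^-1 by rewrite invr_gt0.
    by rewrite -[ltRHS]invrK ltf_pV2 ?posrE; lra.
  have [F1p|F1p] := eqVneq (F1 p) 0.
    have [dlt [al [be [s [d0 a0 b0 s0 H]]]]] := lift_power_law FL F1p.
    have HP x (xp : 0 < `|x - p| < dlt) := let: And3 _ h1 h2 := H x xp in conj h1 h2.
    exists (4 * be / (al * 2^-1 `^ s) + (1 + (dlt / 2)^-1)), (dlt / 2).
    split=> [|x M xp MM v t xv vx xtv]; first by lra.
    have K0 : 0 <= 4 * be / (al * 2^-1 `^ s).
      by rewrite divr_ge0// mulr_ge0 ?powR_ge0//; lra.
    have i0 : 0 < (dlt / 2)^-1 by rewrite invr_gt0; lra.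
    have Mi : M^-1 < dlt / 2 by apply: inv_lt; lra.
    move: xp => /ltr_normlP[xp1 xp2].
    apply: le_trans (power_law_slope_le a0 b0 s0 HP F1p _ xv _ xtv) _; [lra|lra|].
    by apply: ler_wpM2r; [have := F_lt xv; lra|lra].
  have [dlt [m [M2 [d0 m0 M20 H]]]] := lift_noncritical F1p.
  exists (3 + (1 + (dlt / 2)^-1)), (dlt / 2).
  split=> [|x M xp MM v t xv vx xtv]; first by lra.
  have i0 : 0 < (dlt / 2)^-1 by rewrite invr_gt0; lra.
  have Mi : M^-1 < dlt / 2 by apply: inv_lt; lra.
  move: xp => /ltr_normlP[xp1 xp2].
  have [c cxv Fc] := is_derive_MVT xv (fun t _ => dF t).
  have [h1 _ _] : [/\ m <= F1 c, F1 c <= 3 * m & `|F2 c| <= M2].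
    by apply: H; apply/ltr_normlP; split; lra.
  have [_ h2 _] : [/\ m <= F1 t, F1 t <= 3 * m & `|F2 t| <= M2].
    by apply: H; apply/ltr_normlP; split; lra.
  rewrite Fc mulrA ler_pM2r; last by lra.
  have : 3 * F1 c <= M * F1 c by apply: ler_wpM2r; lra.
  by lra.
have Mi0 : 0 < M^-1 by rewrite invr_gt0; lra.
have [k k0 Hk] := lift_gap Mi0.
have [K K0 HK] := lift_deriv_bounded.
have Kk : 0 < K / k by rewrite divr_gt0.
exists (M + K / k); first by lra.
move=> u v t uv utv; have Fuv := F_lt uv.
have [uvM|uvM] := ltP (v - u) M^-1; last first.
  apply: (@le_trans _ _ (K * (v - u))); first by rewrite ler_pM2r//; lra.
  apply: (@le_trans _ _ (K / k * (F v - F u))).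
    by rewrite -mulrA ler_pM2l// ler_pdivlMl//; exact: Hk.
  by rewrite ler_pM2r; lra.
(* An integer translation brings [u] into the unit segment, where [HQ] is available. *)
pose z := - Num.floor u.
have zR : z%:~R = - (Num.floor u)%:~R :> R by rewrite rmorphN.
have /andP[] := floor_itv u; rewrite intrD1 => fl1 fl2.
have := HQ (u + z%:~R) _ (v + z%:~R) (t + z%:~R).
rewrite lift_deriv_addz !lift_addz => h.
have {h} : F1 t * (v + z%:~R - (u + z%:~R)) <= M * (F v + z%:~R - (F u + z%:~R)).
  by apply: h; rewrite zR; lra.
have -> : v + z%:~R - (u + z%:~R) = v - u by ring.
have -> : F v + z%:~R - (F u + z%:~R) = F v - F u by ring.
move=> h; apply: (le_trans h); rewrite ler_pM2r; lra.
Qed.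

End CriticalLiftTheory.

(** * Distortion of cross ratios under one iterate *)

Section CrossRatioStep.
Variables (R : realType) (F F1 F2 F3 : R -> R).
Implicit Types a b c d p t u v x y z m r : R.
Hypothesis FL : critical_lift F F1 F2 F3.

Let dF := lift_d1 FL.
Let dF1 := lift_d2 FL.
Let dF2 := lift_d3 FL.
Let F_lt := lift_lt FL.

Let F_le x y : x <= y -> F x <= F y.
Proof. by rewrite le_eqVlt => /predU1P[->//|/F_lt/ltW]. Qed.

(** The cross ratio [(b - a) * (d - c) / ((c - a) * (d - b))] grows by at most the factor [E], with
    denominators cleared. *)
Definition cross_le E a b c d :=
  (F b - F a) * (F d - F c) * ((c - a) * (d - b)) <=
  E * ((b - a) * (d - c) * ((F c - F a) * (F d - F b))).

Lemma cross_leW E E' a b c d : a < b -> b < c -> c < d -> E <= E' ->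
  cross_le E a b c d -> cross_le E' a b c d.
Proof.
move=> ab bc cd EE' h; apply: (le_trans h).
have Fab := F_lt ab; have Fbc := F_lt bc; have Fcd := F_lt cd.
by apply: ler_wpM2r => //; rewrite !mulr_ge0//; lra.
Qed.

(* The cross ratio of the images divided by that of [a, b, c, d] is a product
   of two quotients of slopes of [F] over intervals, one inside the other. *)
Lemma cross_le_slopes E E' a b c d : a < b -> b < c -> c < d ->
  0 <= E -> 0 <= E' ->
  (F b - F a) * (c - a) <= E * ((b - a) * (F c - F a)) ->
  (F d - F c) * (d - b) <= E' * ((d - c) * (F d - F b)) ->
  cross_le (E * E') a b c d.
Proof.
move=> ab bc cd E0 E'0 h1 h2.
have Fab := F_lt ab; have Fbc := F_lt bc; have Fcd := F_lt cd.
rewrite /cross_le.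
have -> : (F b - F a) * (F d - F c) * ((c - a) * (d - b)) =
   (F b - F a) * (c - a) * ((F d - F c) * (d - b)) by ring.
have -> : E * E' * ((b - a) * (d - c) * ((F c - F a) * (F d - F b))) =
   E * ((b - a) * (F c - F a)) * (E' * ((d - c) * (F d - F b))) by ring.
by apply: ler_pM => //; rewrite mulr_ge0//; lra.
Qed.

(** A coarse bound, insensitive to critical points: each of the two slope quotients of
    [cross_le_slopes] is at most [B]. *)
Lemma slope_cross_le B : 1 <= B ->
  (forall u v t, u < v -> u <= t <= v -> F1 t * (v - u) <= B * (F v - F u)) ->
  forall a b c d, a < b -> b < c -> c < d -> cross_le (B * B) a b c d.
Proof.
move=> B1 HB a b c d ab bc cd.
have ac : a < c by lra.
have bd : b < d by lra.
apply: cross_le_slopes => //; try lra.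
  have [x xab ->] := is_derive_MVT ab (fun t _ => dF t).
  have h : F1 x * (c - a) <= B * (F c - F a) by apply: HB; lra.
  rewrite mulrAC [leRHS]mulrCA [leRHS]mulrC.
  by rewrite ler_pM2r//; lra.
have [x xab ->] := is_derive_MVT cd (fun t _ => dF t).
have h : F1 x * (d - b) <= B * (F d - F b) by apply: HB; lra.
rewrite mulrAC [leRHS]mulrCA [leRHS]mulrC.
by rewrite ler_pM2r//; lra.
Qed.

(** On [a, d] the quotient of two values of [F1] is at most [1 + M2 / m * (d - a)], hence at most an
    exponential; each of the two slope quotients contributes it once. *)
Lemma noncritical_cross_le p m M2 dlt : 0 < m -> 0 <= M2 ->
  (forall x, `|x - p| < dlt -> [/\ m <= F1 x, F1 x <= 3 * m & `|F2 x| <= M2]) ->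
  forall a b c d, p - dlt < a -> a < b -> b < c -> c < d -> d < p + dlt ->
  cross_le (expR (2 * M2 / m * (d - a))) a b c d.
Proof.
move=> m0 M20 H a b c d pa ab bc cd dp.
have Hx x : a <= x <= d -> m <= F1 x /\ `|F2 x| <= M2.
  move=> xad; suff [h1 _ h2] : [/\ m <= F1 x, F1 x <= 3 * m & `|F2 x| <= M2] by [].
  by apply: H; apply/ltr_normlP; split; lra.
have lip x y : a <= x <= d -> a <= y <= d -> F1 x - F1 y <= M2 * (d - a).
  move=> xad yad; have Mda : 0 <= M2 * (d - a) by rewrite mulr_ge0//; lra.
  have [xy|yx|->] := ltgtP x y; last by rewrite subrr.
    have [t tyx e] := is_derive_MVT xy (fun t _ => dF1 t).
    have [_ /ler_normlP[h1 h2]] : m <= F1 t /\ `|F2 t| <= M2 by apply: Hx; lra.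
    have -> : F1 x - F1 y = - F2 t * (y - x) by rewrite mulNr -e opprB.
    by apply: (@le_trans _ _ (M2 * (y - x))); [rewrite ler_pM2r; lra|
       apply: ler_wpM2l; lra].
  have [t tyx ->] := is_derive_MVT yx (fun t _ => dF1 t).
  have [_ /ler_normlP[h1 h2]] : m <= F1 t /\ `|F2 t| <= M2 by apply: Hx; lra.
  by apply: (@le_trans _ _ (M2 * (x - y))); [rewrite ler_pM2r; lra|
       apply: ler_wpM2l; lra].
have L0 : 0 <= M2 / m * (d - a) by rewrite mulr_ge0 ?divr_ge0//; lra.
have ratio x y : a <= x <= d -> a <= y <= d ->
    F1 x <= expR (M2 / m * (d - a)) * F1 y.
  move=> xad yad; have [Fy _] := Hx y yad.
  have := expR_ge1Dx (M2 / m * (d - a)); set e := expR _ => he.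
  have h : (1 + M2 / m * (d - a)) * F1 y <= e * F1 y by apply: ler_wpM2r; lra.
  have h' : M2 / m * (d - a) * m <= M2 / m * (d - a) * F1 y.
    by apply: ler_wpM2l.
  have e' : M2 / m * (d - a) * m = M2 * (d - a) by field; rewrite gt_eqF.
  by have := lip x y xad yad; rewrite e' in h'; lra.
have -> : expR (2 * M2 / m * (d - a)) =
    expR (M2 / m * (d - a)) * expR (M2 / m * (d - a)).
  by rewrite -expRD; congr expR; field; rewrite gt_eqF.
have ac : a < c by lra.
have bd : b < d by lra.
apply: cross_le_slopes => //; rewrite ?expR_ge0//.
  have [x xab ->] := is_derive_MVT ab (fun t _ => dF t).
  have [y yac ->] := is_derive_MVT ac (fun t _ => dF t).
  rewrite [leLHS]mulrAC [leRHS]mulrCA [leRHS]mulrC ler_pM2r; last by lra.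
  by rewrite mulrA ler_pM2r; [apply: ratio|]; lra.
have [x xab ->] := is_derive_MVT cd (fun t _ => dF t).
have [y yac ->] := is_derive_MVT bd (fun t _ => dF t).
rewrite [leLHS]mulrAC [leRHS]mulrCA [leRHS]mulrC ler_pM2r; last by lra.
by rewrite mulrA ler_pM2r; [apply: ratio|]; lra.
Qed.

Lemma critical_side_cross_le p dlt : F1 p = 0 ->
  (forall x, 0 < `|x - p| < dlt ->
     0 < F1 x /\ F3 x / F1 x - 3 / 2 * (F2 x / F1 x) ^+ 2 < 0) ->
  forall a b c d, p - dlt < a -> a < b -> b < c -> c < d -> d < p + dlt ->
  (forall t, a <= t <= d -> F1 t != 0) -> cross_le 1 a b c d.
Proof.
move=> F1p H a b c d pa ab bc cd dp F1n.
have Hx x : a <= x <= d ->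
    0 < F1 x /\ F3 x / F1 x - 3 / 2 * (F2 x / F1 x) ^+ 2 < 0.
  move=> xad; apply: H; apply/andP; split.
    rewrite normr_gt0 subr_eq0; apply: contraTneq (F1n x xad) => ->.
    by rewrite F1p eqxx.
  by apply/ltr_normlP; split; lra.
rewrite /cross_le mul1r.
apply: (schwarzian_cross_ratio dF dF1 dF2) => // x xad.
  by have [] := Hx x xad.
by have [_ /ltW] := Hx x xad.
Qed.

Let F_addz x (k : int) : F (x + k%:~R) = F x + k%:~R := lift_addz FL x k.
Let F1_addz x (k : int) : F1 (x + k%:~R) = F1 x := lift_deriv_addz FL x k.

(** Here [M] is both the inverse of a length scale and the distortion constant. Near a critical
    point the Schwarzian derivative gives the factor 1, and elsewhere [noncritical_cross_le]
    applies. *)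
Lemma small_noncritical_cross_le : exists2 M : R, 1 <= M &
  forall a b c d, a < b -> b < c -> c < d -> d < a + M^-1 ->
  (forall t, a <= t <= d -> F1 t != 0) -> cross_le (expR (M * (d - a))) a b c d.
Proof.
pose Q (M : R) a := forall b c d, a < b -> b < c -> c < d -> d < a + M^-1 ->
  (forall t, a <= t <= d -> F1 t != 0) -> cross_le (expR (M * (d - a))) a b c d.
have [p|M M1 HQ] := @unit_segment_uniform R Q.
  have inv_lt (e M : R) : 0 < e -> 1 + e^-1 <= M -> M^-1 < e.
    move=> e0 Me; have ei : 0 < e^-1 by rewrite invr_gt0.
    by rewrite -[ltRHS]invrK ltf_pV2 ?posrE; lra.
  have [F1p|F1p] := eqVneq (F1 p) 0.
    have [dlt [al [be [s [d0 a0 b0 s0 H]]]]] := lift_power_law FL F1p.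
    exists (1 + (dlt / 2)^-1), (dlt / 2).
    split=> [|a M ap MM b c d ab bc cd da F1n]; first by lra.
    have i0 : 0 < (dlt / 2)^-1 by rewrite invr_gt0; lra.
    have Mi : M^-1 < dlt / 2 by apply: inv_lt; lra.
    move: ap => /ltr_normlP[ap1 ap2].
    have E1 : 1 <= expR (M * (d - a)) by rewrite -expR0 ler_expR mulr_ge0; lra.
    apply: (cross_leW ab bc cd E1).
    have H' x : 0 < `|x - p| < dlt ->
        0 < F1 x /\ F3 x / F1 x - 3 / 2 * (F2 x / F1 x) ^+ 2 < 0.
      move=> xp; have [h1 h2 _] := H x xp; split=> //.
      by apply: le_lt_trans h2; rewrite mulr_ge0 ?powR_ge0//; lra.
    by apply: (critical_side_cross_le F1p H' _ ab bc cd _ F1n); lra.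
  have [dlt [m [M2 [d0 m0 M20 H]]]] := lift_noncritical FL F1p.
  exists (2 * M2 / m + (1 + (dlt / 2)^-1)), (dlt / 2).
  split=> [|a M ap MM b c d ab bc cd da F1n]; first by lra.
  have K0 : 0 <= 2 * M2 / m by rewrite divr_ge0//; lra.
  have i0 : 0 < (dlt / 2)^-1 by rewrite invr_gt0; lra.
  have Mi : M^-1 < dlt / 2 by apply: inv_lt; lra.
  move: ap => /ltr_normlP[ap1 ap2].
  have EE : expR (2 * M2 / m * (d - a)) <= expR (M * (d - a)).
    by rewrite ler_expR; apply: ler_wpM2r; lra.
  apply: (cross_leW ab bc cd EE).
  by apply: (noncritical_cross_le m0 M20 H) ab bc cd _; lra.
exists M => // a b c d ab bc cd da F1n.
pose k := - Num.floor a.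
have kR : k%:~R = - (Num.floor a)%:~R :> R by rewrite rmorphN.
have /andP[] := floor_itv a; rewrite intrD1 => fl1 fl2.
have := HQ (a + k%:~R) _ (b + k%:~R) (c + k%:~R) (d + k%:~R).
have E x y : x + k%:~R - (y + k%:~R) = x - y by ring.
rewrite /cross_le !F_addz !E; apply; rewrite ?kR; try lra.
move=> t tad; have -> : t = t - k%:~R + k%:~R by ring.
by rewrite F1_addz F1n// kR; lra.
Qed.

(** The coarse factor [B * B] is affordable on intervals that are long or contain a critical point,
    since [Phi] grows there by at least [2 * ln B]; the remaining intervals fall under
    [small_noncritical_cross_le]. *)
Lemma cross_ratio_step : exists (Phi : R -> R) (P : R),
  [/\ {homo Phi : x y / x <= y}, forall x, Phi (x + 1) = Phi x + P &
      forall a b c d, a < b -> b < c -> c < d ->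
        cross_le (expR (Phi d - Phi a)) a b c d].
Proof.
have [M M1 HM] := small_noncritical_cross_le.
have [B B1 HB] := lift_slope_le FL.
have [N [r Hr]] := lift_critical FL.
(* [K >= M] serves short intervals without critical points, [K >= 2 * ln B] a jump of some [V i],
   and [K / M >= 2 * ln B] intervals of length at least [M^-1]. *)
pose K := M * (1 + 2 * ln B).
have lnB : 0 <= ln B by rewrite ln_ge0.
have K1 : M <= K by rewrite /K ler_peMr; lra.
have KB : 2 * ln B <= K.
  apply: (@le_trans _ _ (1 * (1 + 2 * ln B))); first by lra.
  by rewrite /K ler_wpM2r; lra.
(* [floor + ceil] jumps on any closed interval containing an integer, even as
   an end point: critical points are thus counted at both ends. *)
pose V (i : 'I_N) x : R :=
  (Num.floor (x - r i) + Num.ceil (x - r i))%:~R.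
have V_le i x y : x <= y -> V i x <= V i y.
  move=> xy; rewrite /V ler_int lerD//.
    by apply: le_floor; lra.
  by apply: le_ceil; lra.
have V_crit i x y c : x < y -> x <= c <= y -> c - r i \is a Num.int ->
    V i x + 1 <= V i y.
  move=> xy xcy /intrP[z cz].
  rewrite /V -(intrD _ _ 1) ler_int.
  have h1 : Num.floor (x - r i) <= z.
    by rewrite -(intrKfloor (R:=R) z) -cz; apply: le_floor; lra.
  have h2 : Num.ceil (x - r i) <= z.
    by rewrite -(intrKceil (R:=R) z) -cz; apply: le_ceil; lra.
  have h3 : z <= Num.floor (y - r i).
    by rewrite -(intrKfloor (R:=R) z) -cz; apply: le_floor; lra.
  have h4 : z <= Num.ceil (y - r i).
    by rewrite -(intrKceil (R:=R) z) -cz; apply: le_ceil; lra.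
  have [xc|cx] := ltP x c.
    have h5 : Num.floor (x - r i) < z by rewrite floor_lt_int -cz; lra.
    by rewrite addrAC lerD ?lezD1 ?(lt_le_trans h5) ?(le_trans h2).
  have h5 : z < Num.ceil (y - r i) by rewrite ceil_gt_int -cz; lra.
  by rewrite -addrA lerD ?lezD1 ?(le_lt_trans h2) ?(le_trans h1).
have V_add1 i x : V i (x + 1) = V i x + 2.
  rewrite /V addrAC (floorDrz _ (intr_int _ 1)) (ceilDrz _ (intr_int _ 1)).
  by rewrite (intrKfloor (R:=R) 1) (intrKceil (R:=R) 1) !intrD; ring.
pose Phi x : R := K * (x + \sum_i V i x).
have Phi_le x y : x <= y -> Phi x <= Phi y.
  move=> xy; apply: ler_wpM2l; first by lra.
  by apply: lerD => //; apply: ler_sum => i _; exact: V_le.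
exists Phi, (K * (1 + \sum_(i < N) 2)); split => //.
  move=> x; rewrite /Phi (eq_bigr _ (fun i _ => V_add1 i x)) big_split /=.
  by ring.
move=> a b c d ab bc cd.
have big : 2 * ln B <= Phi d - Phi a -> cross_le (expR (Phi d - Phi a)) a b c d.
  move=> h; have BB : B * B <= expR (Phi d - Phi a).
    have -> : B * B = expR (2 * ln B).
      by rewrite mulrDl mul1r expRD lnK// posrE; lra.
    by rewrite ler_expR.
  exact: (cross_leW ab bc cd BB (slope_cross_le B1 HB ab bc cd)).
have sum_le : \sum_i V i a <= \sum_i V i d.
  by apply: ler_sum => i _; apply: V_le; lra.
have Phi_ge : K * (d - a) <= Phi d - Phi a.
  by rewrite /Phi -mulrBr ler_wpM2l; lra.
have [[t tad F1t]|nocrit] := pselect (exists2 t, a <= t <= d & F1 t = 0).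
  apply: big; have [i ti] := Hr t F1t.
  have h1 : V i a + 1 <= V i d by apply: (V_crit i a d t) => //; lra.
  have h2 : \sum_i V i a + 1 <= \sum_i V i d.
    rewrite (bigD1 i)//= [leRHS](bigD1 i)//=.
    have : \sum_(j < N | j != i) V j a <= \sum_(j < N | j != i) V j d.
      by apply: ler_sum => j _; apply: V_le; lra.
    by lra.
  apply: (le_trans KB); rewrite /Phi -mulrBr -[leLHS]mulr1 ler_wpM2l; lra.
have [da|da] := ltP d (a + M^-1).
  have EE : expR (M * (d - a)) <= expR (Phi d - Phi a).
    by rewrite ler_expR; apply: le_trans Phi_ge; rewrite ler_wpM2r; lra.
  apply: (cross_leW ab bc cd EE); apply: (HM a b c d ab bc cd da) => t tad.
  by apply/eqP => F1t; apply: nocrit; exists t.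
apply: big; apply: le_trans Phi_ge.
apply: (@le_trans _ _ (K * M^-1)); last by rewrite ler_wpM2l; lra.
rewrite /K mulrAC mulfV ?mul1r; [lra|].
by rewrite gt_eqF; lra.
Qed.

(* The quotient of the two image lengths is of order [(r / m) ^ (s + 1)] and
   [s > 0], whence a factor [eta] as small as wanted in front of [r / m]. *)
Lemma critical_asymmetry c eta : F1 c = 0 -> 0 < eta ->
  exists2 e, 0 < e & forall r m, 0 < r -> 0 < m -> m <= 1 -> r <= e * m ->
    (F c - F (c - r)) * m <= eta * r * (F (c + m) - F c) /\
    (F (c + r) - F c) * m <= eta * r * (F c - F (c - m)).
Proof.
move=> F1c eta0.
have [dlt [al [be [s [d0 a0 b0 s0 H]]]]] := lift_power_law FL F1c.
have HP x (xp : 0 < `|x - c| < dlt) := let: And3 _ h1 h2 := H x xp in conj h1 h2.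
(* These bounds keep [r] and the interval [c + w, c + 2 w], over which the increase of [F] is
   measured, inside the range of the power law. *)
have [th [th0 th1 th2]] : exists th, [/\ 0 < th, th <= 1 & th <= dlt / 2].
  exists (Num.min 1 (dlt / 2)).
  by rewrite lt_min !ge_min !lexx orbT ltr01/=; split=> //; lra.
have [kap0 th20] : 0 < eta * (th / 2) * al / be /\ 0 < th / 2.
  by rewrite !divr_gt0 ?mulr_gt0 ?divr_gt0.
(* If [r] is at most [w] times the [s]-th root of [kap], the upper bound for the derivative at
   distance [r] is at most [eta * (th / 2)] times the lower bound at distance [w]. *)
set kap := eta * (th / 2) * al / be in kap0.
have [e [e0 eth ek]] : exists e, [/\ 0 < e, e <= th & e <= kap `^ s^-1 * (th / 2)].
  exists (Num.min th (kap `^ s^-1 * (th / 2))).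
  by rewrite lt_min th0 mulr_gt0 ?powR_gt0// !ge_min !lexx orbT.
exists e => // r m r0 m0 m1 rm.
pose w := th / 2 * m.
have w0 : 0 < w by rewrite mulr_gt0.
have rs : be * r `^ s <= eta * (th / 2) * (al * w `^ s).
  have -> : eta * (th / 2) * (al * w `^ s) = be * (kap * w `^ s).
    by rewrite /kap; field; rewrite gt_eqF.
  rewrite ler_pM2l//.
  have {1}<- : (kap `^ s^-1) `^ s = kap.
    by rewrite -powRrM mulVf ?gt_eqF// powRr1// ltW.
  rewrite -powRM ?powR_ge0 ?(ltW w0)//.
  have rkw : r <= kap `^ s^-1 * w.
    by apply: (le_trans rm); rewrite /w mulrA; apply: ler_wpM2r => //; exact: ltW.
  have kw0 : 0 <= kap `^ s^-1 * w by apply: le_trans rkw; exact: ltW.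
  by apply: ge0_ler_powR; rewrite ?nnegrE//; exact: ltW.
have final X Y : X <= be * r `^ s * r -> al * w `^ s * w <= Y ->
    X * m <= eta * r * Y.
  move=> hX hY; apply: (@le_trans _ _ (eta * r * (al * w `^ s * w))); last first.
    by rewrite ler_pM2l// mulr_gt0.
  have -> : eta * r * (al * w `^ s * w) = eta * (th / 2) * (al * w `^ s) * (r * m).
    by rewrite /w; ring.
  apply: (@le_trans _ _ (be * r `^ s * r * m)); first by rewrite ler_pM2r.
  by rewrite -[leLHS]mulrA ler_wpM2r// mulr_ge0 ?ltW.
have [w2m w2d] : w + w <= m /\ w + w < dlt.
  have thm : th * m <= th by rewrite ler_piMr// ltW.
  have thm' : th * m <= m by rewrite ler_piMl// ltW.
  by rewrite /w; lra.
have rd : r < dlt.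
  have em : e * m <= e by rewrite ler_piMr// ltW.
  lra.
clear - F_le FL HP F1c a0 b0 s0 w0 w2m w2d rd r0 m0 final.
split; apply: final.
- have -> : be * r `^ s * r = be * r `^ s * (c - (c - r)) by ring.
  apply: (power_law_increment_le FL b0 s0 HP F1c (ltW r0) rd) => [|x xc].
    by lra.
  by rewrite ltr0_norm; lra.
- have -> : al * w `^ s * w = al * w `^ s * (c + (w + w) - (c + w)) by ring.
  apply: (@le_trans _ _ (F (c + (w + w)) - F (c + w))).
    apply: (power_law_increment_ge FL a0 s0 HP w0) => [|x xc]; first by lra.
    by rewrite gtr0_norm; lra.
  by apply: lerB; apply: F_le; lra.
- have -> : be * r `^ s * r = be * r `^ s * (c + r - c) by ring.
  apply: (power_law_increment_le FL b0 s0 HP F1c (ltW r0) rd) => [|x xc].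
    by lra.
  by rewrite gtr0_norm; lra.
- have -> : al * w `^ s * w = al * w `^ s * (c - w - (c - (w + w))) by ring.
  apply: (@le_trans _ _ (F (c - w) - F (c - (w + w)))).
    apply: (power_law_increment_ge FL a0 s0 HP w0) => [|x xc]; first by lra.
    by rewrite ltr0_norm; lra.
  by apply: lerB; apply: F_le; lra.
Qed.

End CrossRatioStep.

(** * Continued fractions *)

Section ContinuedFraction.
Variables (R : realType) (rho : R).
Hypothesis rho_gt0 : 0 < rho.
Hypothesis rho_lt1 : rho < 1.
Hypothesis rho_irrational : forall n (k : int), (0 < n)%N -> n%:R * rho != k%:~R.

(** Numerators of the convergents with denominators [cf_denom]. *)
Fixpoint cf_num (rho : R) (n : nat) : nat :=
  match n with
  | 0 => 0
  | n'.+1 =>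
    match n' with
    | 0 => 1
    | n''.+1 => (cf_digit rho n' * cf_num rho n' + cf_num rho n'')%N
    end
  end.

Local Notation q := (cf_denom rho).
Local Notation p := (cf_num rho).
Local Notation th := (fun n => iter n (@gauss R) rho).

Definition cf_error n : R := (q n)%:R * rho - (p n)%:R.
Local Notation err := cf_error.

Lemma cf_denomSS n : q n.+2 = (cf_digit rho n.+1 * q n.+1 + q n)%N.
Proof. by []. Qed.

Lemma cf_numSS n : p n.+2 = (cf_digit rho n.+1 * p n.+1 + p n)%N.
Proof. by []. Qed.

Lemma cf_errorSS n : err n.+2 = (cf_digit rho n.+1)%:R * err n.+1 + err n.
Proof. by rewrite /err cf_denomSS cf_numSS !natrD !natrM; ring. Qed.

Lemma gaussE (x : R) : 0 < x -> gauss x = x^-1 - (Num.truncn x^-1)%:R.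
Proof.
move=> x0; rewrite /gauss /frac_part; congr (_ - _).
by rewrite truncn_floor invr_ge0 (ltW x0) pmulrn gez0_abs// floor_ge0 invr_ge0 ltW.
Qed.

Lemma digit_gt0 (x : R) : 0 < x < 1 -> (0 < Num.truncn x^-1)%N.
Proof.
by move=> /andP[x0 x1]; rewrite truncn_gt0 invf_ge1// ltW.
Qed.

Lemma cf_main n : [/\ 0 < th n < 1, 0 < th n.+1 < 1, (0 < q n)%N, (q n <= q n.+1)%N
  & err n.+1 = - th n.+1 * err n].
Proof.
have gauss_itv (x : R) : 0 < x -> gauss x != 0 -> 0 < gauss x < 1.
  move=> x0 gx; rewrite lt_def gx /=.
  have /andP[] := floor_itv x^-1; rewrite intrD1 => h1 h2.
  by rewrite /gauss /frac_part; apply/andP; split; lra.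
have errn0 m : (0 < q m)%N -> err m != 0.
  by move=> qm; rewrite /err subr_eq0; exact: (rho_irrational (p m)%:Z qm).
elim: n => [|n [h1 h2 q0 qq e]].
  have th0 : 0 < rho < 1 by rewrite rho_gt0.
  have q1 : (0 < q 1)%N by exact: digit_gt0.
  have e : err 1 = - gauss rho * err 0.
    rewrite /err /= gaussE// /cf_digit /= mul1r subr0.
    rewrite mulNr mulrBl mulVf ?gt_eqF//; ring.
  have t1 : gauss rho != 0.
    apply/eqP => t1; have := errn0 1%N q1.
    by rewrite e t1 oppr0 mul0r eqxx.
  by split=> //; exact: gauss_itv rho_gt0 t1.
have dg : (0 < cf_digit rho n.+1)%N by exact: digit_gt0.
have q1 : (0 < q n.+1)%N by exact: leq_trans q0 qq.
have q2 : (q n.+1 <= q n.+2)%N.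
  by rewrite cf_denomSS; apply: leq_trans (leq_addr _ _); rewrite leq_pmull.
have th0 : 0 < th n.+1 by case/andP: h2.
have e' : err n.+2 = - th n.+2 * err n.+1.
  rewrite cf_errorSS /=; change (gauss (iter n (@gauss R) rho)) with (th n.+1).
  rewrite gaussE// /cf_digit e.
  by field; rewrite gt_eqF.
have t2 : th n.+2 != 0.
  apply/eqP => t2; have := errn0 n.+2 (leq_trans q1 q2).
  by rewrite e' t2 oppr0 mul0r eqxx.
by split=> //; exact: gauss_itv th0 t2.
Qed.

Lemma cf_denom_gt0 n : (0 < q n)%N.
Proof. by case: (cf_main n). Qed.

Lemma cf_denom_leS n : (q n <= q n.+1)%N.
Proof. by case: (cf_main n). Qed.

Lemma cf_errorS n : err n.+1 = - th n.+1 * err n.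
Proof. by case: (cf_main n). Qed.

Lemma gauss_iter_itv n : 0 < th n < 1.
Proof. by case: (cf_main n). Qed.

Lemma cf_error_sign n : 0 < (-1) ^+ n * err n < 1.
Proof.
elim: n => [|n /andP[IH1 IH2]].
  by rewrite /err /= !mul1r subr0 rho_gt0.
have /andP[t0 t1] := gauss_iter_itv n.+1.
rewrite exprS cf_errorS.
have -> : -1 * (-1) ^+ n * (- th n.+1 * err n) = th n.+1 * ((-1) ^+ n * err n).
  by ring.
rewrite mulr_gt0//=; apply: (lt_trans _ t1).
by rewrite gtr_pMr.
Qed.

Lemma cf_det n :
  (q n.+1)%:Z * (p n)%:Z - (q n)%:Z * (p n.+1)%:Z = (-1) ^+ n.+1 :> int.
Proof.
elim: n => [|n IH]; first by rewrite /= mulr0 mulr1 sub0r expr1.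
rewrite cf_denomSS cf_numSS exprS -IH !PoszD !PoszM; ring.
Qed.

(** By [cf_det], the pair [(j, k)] is an integer combination, with coefficients [u] and [v], of two
    consecutive convergents. The bounds on [j] force [u] to be nonzero and [v] to be zero or of the
    opposite sign; as consecutive errors alternate in sign, the two contributions add up in absolute
    value. *)
Lemma cf_best_approx n j (k : int) : (0 < j < q n.+1)%N ->
  `|err n| <= `|j%:R * rho - k%:~R|.
Proof.
move=> /andP[j0 jq].
pose s : int := (-1) ^+ n.+1.
have ss : s * s = 1 by rewrite /s -exprMn mulrNN mul1r expr1n.
pose u := s * ((q n.+1)%:Z * k - (p n.+1)%:Z * j%:Z).
pose v := s * ((p n)%:Z * j%:Z - (q n)%:Z * k).
have ej : j%:Z = u * (q n)%:Z + v * (q n.+1)%:Z.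
  transitivity (s * s * j%:Z); first by rewrite ss mul1r.
  by rewrite /u /v {2}/s -cf_det; ring.
have ek : k = u * (p n)%:Z + v * (p n.+1)%:Z.
  transitivity (s * s * k); first by rewrite ss mul1r.
  by rewrite /u /v {2}/s -cf_det; ring.
have q0 := cf_denom_gt0 n; have q1 := cf_denom_gt0 n.+1.
have uv : (1 <= u /\ v <= 0) \/ (u <= -1 /\ 0 <= v).
  have [v0|v0] := leP v 0.
    left; split=> //; have [//|u0] := leP 1 u.
    have h1 : u * (q n)%:Z <= 0 by nia.
    have h2 : v * (q n.+1)%:Z <= 0 by nia.
    lia.
  right; split; last by lia.
  have [//|u0] := leP u (-1).
  have h1 : 0 <= u * (q n)%:Z by nia.
  have h2 : (q n.+1)%:Z <= v * (q n.+1)%:Z by nia.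
  lia.
have -> : j%:R * rho - k%:~R = (u%:~R - v%:~R * th n.+1) * err n.
  have -> : j%:R = (j%:Z)%:~R :> R by [].
  have -> : (u%:~R - v%:~R * th n.+1) * err n = u%:~R * err n + v%:~R * err n.+1.
    by rewrite cf_errorS; ring.
  by rewrite ej [in LHS]ek !intrD !intrM -!pmulrn /err; ring.
rewrite normrM ler_peMl//.
have /andP[t0 _] := gauss_iter_itv n.+1.
case: uv => -[u1 v0].
  have u1' : 1 <= u%:~R :> R by rewrite (ler_int _ 1).
  have v0' : v%:~R <= 0 :> R by rewrite (ler_int _ _ 0).
  have : v%:~R * th n.+1 <= 0 by rewrite mulr_le0_ge0// ltW.
  by move=> h; rewrite ger0_norm; lra.
have u1' : u%:~R <= -1 :> R by rewrite -[-1](intrN _ 1) ler_int.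
have v0' : 0 <= v%:~R :> R by rewrite (ler_int _ 0).
have : 0 <= v%:~R * th n.+1 by rewrite mulr_ge0// ltW.
by move=> h; rewrite ler0_norm; lra.
Qed.

End ContinuedFraction.

(** * Geometry of closest returns *)

Section CrossRatio.
Variable R : realType.
Implicit Types a b c d x y z t : R.

Definition cross_ratio a b c d := (b - a) * (d - c) / ((c - a) * (d - b)).

Lemma cross_ratio_opp a b c d :
  cross_ratio (- d) (- c) (- b) (- a) = cross_ratio a b c d.
Proof.
by rewrite /cross_ratio; congr (_ / _); ring.
Qed.

Lemma cross_ratio_add a b c d x :
  cross_ratio (a + x) (b + x) (c + x) (d + x) = cross_ratio a b c d.
Proof. by rewrite /cross_ratio; congr (_ / _); ring. Qed.

Lemma cross_ratio_ge0 a b c d : a < b -> b < c -> c < d ->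
  0 <= cross_ratio a b c d.
Proof. by move=> ab bc cd; rewrite divr_ge0// mulr_ge0//; lra. Qed.

(** A lower bound for the cross ratio thus prevents an outer interval from being short compared with
    the middle one. *)
Lemma cross_ratio_le_left a b c d : a < b -> b < c -> c < d ->
  cross_ratio a b c d * (c - b) <= b - a.
Proof.
move=> ab bc cd; rewrite /cross_ratio mulrAC ler_pdivrMr; last by rewrite mulr_gt0; lra.
rewrite -!mulrA ler_pM2l; last by lra.
rewrite mulrC; apply: ler_pM; lra.
Qed.

Lemma cross_ratio_le_right a b c d : a < b -> b < c -> c < d ->
  cross_ratio a b c d * (c - b) <= d - c.
Proof.
move=> ab bc cd; rewrite -cross_ratio_opp.
have -> : c - b = - b - - c by ring.
have -> : d - c = - c - - d by ring.
by apply: cross_ratio_le_left; lra.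
Qed.

Lemma cross_ratio_ge K a b c d : a < b -> b < c -> c < d -> 0 <= K ->
  c - b <= K * (b - a) -> c - b <= K * (d - c) ->
  1 <= (1 + K) ^+ 2 * cross_ratio a b c d.
Proof.
move=> ab bc cd K0 h1 h2.
rewrite /cross_ratio mulrA ler_pdivlMr ?mul1r; last by rewrite mulr_gt0; lra.
have -> : (1 + K) ^+ 2 * ((b - a) * (d - c)) =
  ((1 + K) * (b - a)) * ((1 + K) * (d - c)) by ring.
by apply: ler_pM; lra.
Qed.

(** Induction on the number of intervals: the first one separates the others into those on its left
    and those on its right. *)
Lemma sum_disjoint_increments (Phi : R -> R) (s : seq nat) (u v : nat -> R) A B :
  {homo Phi : x y / x <= y} -> A <= B -> uniq s ->
  (forall i, i \in s -> [/\ A <= u i, u i <= v i & v i <= B]) ->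
  (forall i j, i \in s -> j \in s -> i != j -> v i <= u j \/ v j <= u i) ->
  \sum_(i <- s) (Phi (v i) - Phi (u i)) <= Phi B - Phi A.
Proof.
move=> Phi_le; have [n] := ubnP (size s); elim: n => // n IH in s A B *.
case: s => [|i s] /= sz AB; first by rewrite big_nil subr_ge0 Phi_le.
move=> /andP[is_ us] inAB dis.
have [Aui uvi viB] := inAB i (mem_head _ _).
rewrite big_cons (bigID (fun j => v j <= u i)) /= -(big_filter s (fun j => v j <= u i)).
rewrite -(big_filter s (fun j => ~~ (v j <= u i))).
have szf (a : pred nat) : (size [seq j <- s | a j] < n)%N.
  by apply: (@leq_ltn_trans (size s)) => //; rewrite size_filter count_size.
have h1 : \sum_(j <- [seq j <- s | v j <= u i]) (Phi (v j) - Phi (u j)) <=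
    Phi (u i) - Phi A.
  apply: (IH _ _ _ (szf _) Aui) => [|j|j k]; first by rewrite filter_uniq.
    rewrite mem_filter => /andP[vju js].
    by have [] := inAB j (mem_behead (s := i :: s) js).
  rewrite !mem_filter => /andP[_ js] /andP[_ ks].
  exact: dis (mem_behead (s := i :: s) js) (mem_behead (s := i :: s) ks).
have h2 : \sum_(j <- [seq j <- s | ~~ (v j <= u i)]) (Phi (v j) - Phi (u j)) <=
    Phi B - Phi (v i).
  apply: (IH _ _ _ (szf _) viB) => [|j|j k]; first by rewrite filter_uniq.
    rewrite mem_filter => /andP[vju js].
    have [h1j h2j h3j] := inAB j (mem_behead (s := i :: s) js).
    split=> //; have ij : i != j by apply: contraNneq is_ => ->.
    have [//|h] := dis i j (mem_head _ _) (mem_behead (s := i :: s) js) ij.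
    by rewrite h in vju.
  rewrite !mem_filter => /andP[_ js] /andP[_ ks].
  exact: dis (mem_behead (s := i :: s) js) (mem_behead (s := i :: s) ks).
by lra.
Qed.

End CrossRatio.

(** * Closest returns and distortion along their orbits *)

Section Levels.
Variable R : realType.
Implicit Types x y z t : R.

(* [Phi] majorizes the distortion of cross ratios by an additive function of
   intervals, with total mass [P] on the circle. *)
Record distortion_lift (F : R -> R) (tau : R) (Phi : R -> R) (P : R) : Prop :=
  DistortionLift {
  dl_map : circle_lift_map F tau;
  dl_le : {homo Phi : x y / x <= y};
  dl_add1 : forall x, Phi (x + 1) = Phi x + P;
  dl_step : forall a b c d, a < b -> b < c -> c < d ->
    cross_ratio (F a) (F b) (F c) (F d) <=
    expR (Phi d - Phi a) * cross_ratio a b c d }.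

Lemma distortion_lift_opp F tau Phi P : distortion_lift F tau Phi P ->
  distortion_lift (fun x => - F (- x)) (- tau) (fun x => - Phi (- x)) P.
Proof.
move=> [HF Hle Hadd Hstep]; split.
- exact: clm_opp.
- by move=> x y xy; rewrite lerN2 Hle// lerN2.
- by move=> x; have := Hadd (- x - 1); rewrite subrK => ->; rewrite !opprD subrK.
- move=> a b c d ab bc cd; rewrite cross_ratio_opp -[in leRHS]cross_ratio_opp.
  have -> : - Phi (- d) - - Phi (- a) = Phi (- a) - Phi (- d) by ring.
  by apply: Hstep; rewrite ltrN2.
Qed.

(* Two consecutive convergents [p / q] and [p' / q'], the first one from below:
   [F ^ q - p] moves points forward and [F ^ q' - p'] moves them backward.
   Levels of the other parity are obtained by conjugation with [x |-> - x]. *)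
Record level (tau : R) (q q' : nat) (p p' : int) : Prop := Level {
  lv_gt0 : (0 < q)%N;
  lv_le : (q <= q')%N;
  lv_fwd : 0 < q%:R * tau - p%:~R < 1;
  lv_bwd : - (q%:R * tau - p%:~R) < q'%:R * tau - p'%:~R < 0;
  lv_best : forall j (k : int), (0 < j < q')%N ->
    q%:R * tau - p%:~R <= `|j%:R * tau - k%:~R| }.

Section OneLevel.
Variables (F : R -> R) (tau : R) (Phi : R -> R) (P : R).
Hypothesis DL : distortion_lift F tau Phi P.
Variables (q q' : nat) (p p' : int).
Hypothesis LV : level tau q q' p p'.

Let CF := dl_map DL.
Let F_lt := clm_lt CF.
Let F_add1 := clm_add1 CF.
Let F_addz := iter_addz F_add1.

Definition return_map (n : nat) (k : int) x := iter n F x - k%:~R.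
Local Notation g := (return_map q p).
Local Notation g' := (return_map q' p').

Lemma return_map_lt n k x y : x < y -> return_map n k x < return_map n k y.
Proof. by move=> xy; rewrite /return_map ltrD2r iter_lt. Qed.

Lemma return_map_le n k x y : x <= y -> return_map n k x <= return_map n k y.
Proof. by move=> xy; rewrite /return_map lerD2r iter_le. Qed.

Lemma return_map_iter n k m x :
  iter m F (return_map n k x) = return_map n k (iter m F x).
Proof. by rewrite /return_map -rmorphN/= F_addz -!iterD addnC. Qed.

Lemma return_map_addz n k x (z : int) :
  return_map n k (x + z%:~R) = return_map n k x + z%:~R.
Proof. by rewrite /return_map F_addz addrAC. Qed.

Lemma return_mapC n k m l x :
  return_map n k (return_map m l x) = return_map m l (return_map n k x).
Proof.
by rewrite /return_map -!rmorphN/= !F_addz -!iterD (addnC n) addrAC.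
Qed.

Lemma return_map_surj n k y : exists x, return_map n k x = y.
Proof.
have [x e] := clm_surjective CF n (y + k%:~R).
by exists x; rewrite /return_map e addrK.
Qed.

Lemma return_map_lt_translation n k m l x :
  n%:R * tau - k%:~R < m%:R * tau - l%:~R -> return_map n k x < return_map m l x.
Proof.
move=> h; have := @orbit_lt _ F tau n m (- k) (- l) x CF.
by rewrite !rmorphN; exact.
Qed.

Lemma return_map_gt x : x < g x.
Proof.
have := @return_map_lt_translation 0 0 q p x; rewrite /return_map/= subr0 mul0r subr0.
by apply; case/andP: (lv_fwd LV).
Qed.

Lemma return_map_lt_add1 x : g x < x + 1.
Proof.
have := @return_map_lt_translation q p 0 (-1) x.
rewrite /return_map/= rmorphN/= opprK mul0r add0r.
by apply; case/andP: (lv_fwd LV).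
Qed.

Lemma return_map_next_lt x : g' x < x.
Proof.
have := @return_map_lt_translation q' p' 0 0 x; rewrite /return_map/= subr0 mul0r subr0.
by apply; case/andP: (lv_bwd LV).
Qed.

Lemma return_map_next_gt x : x < g (g' x).
Proof.
have [_ /andP[h _]] := (lv_fwd LV, lv_bwd LV).
have := @orbit_lt _ F tau 0 (q + q')%N 0 (- p - p') x CF.
rewrite /return_map mul0r !addr0 iterD -!rmorphN/= F_addz.
rewrite rmorphB/= rmorphN/= natrD => H.
have := H ltac:(lra); rewrite !rmorphN/=; lra.
Qed.

(** The first [q'] images of [y, g y], moved by integers into [y, y + 1], do not overlap, because by
    [lv_best] no difference of two of these times gives a return closer than [g]. *)
Lemma sum_return_increments y :
  \sum_(i < q') (Phi (iter i F (g y)) - Phi (iter i F y)) <= P.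
Proof.
have Phi_addz x (k : int) y0 : Phi (x + k%:~R) - Phi (y0 + k%:~R) = Phi x - Phi y0.
  have Hn (n : nat) w : Phi (w + n%:R) = Phi w + n%:R * P.
    elim: n w => [|n IH] w; first by rewrite !addr0 mul0r addr0.
    by rewrite -natr1 addrA (dl_add1 DL) IH; ring.
  case: k => n; first by rewrite !Hn; ring.
  have Hm w : Phi (w + (Negz n)%:~R) = Phi w - n.+1%:R * P.
    rewrite -[in RHS](subrK n.+1%:R w) Hn NegzE rmorphN/=; ring.
  by rewrite !Hm; ring.
pose k i := - Num.floor (iter i F y - y).
pose u i := iter i F y + (k i)%:~R.
pose v i := iter i F (g y) + (k i)%:~R.
have kR i : (k i)%:~R = - (Num.floor (iter i F y - y))%:~R :> R by rewrite rmorphN.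
have u_itv i : y <= u i < y + 1.
  have /andP[] := floor_itv (iter i F y - y); rewrite intrD1 /u kR; lra.
have u_v i : u i <= v i.
  by rewrite /u /v lerD2r iter_le// ltW// return_map_gt.
have vE i : v i = iter (i + q) F y + (k i - p)%:~R.
  by rewrite /v return_map_iter /return_map -iterD addnC rmorphB/=; ring.
have dis i j (a b : int) : (i < q')%N -> (j < q')%N -> i != j ->
    iter (i + q) F y + (a - p)%:~R <= iter j F y + b%:~R \/
    iter (j + q) F y + (b - p)%:~R <= iter i F y + a%:~R.
  wlog ij : i j a b / (i < j)%N.
    move=> W iq jq ij; have [lij|lij] := ltnP i j; first exact: W.
    have ji' : j != i by rewrite eq_sym.
    have ji : (j < i)%N by rewrite ltn_neqAle ji'.
    by have [h|h] := W j i b a ji jq iq ji'; [right|left].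
  move=> iq jq _; have n0 : (0 < j - i < q')%N.
    by rewrite subn_gt0 ij/=; apply: leq_ltn_trans jq; exact: leq_subr.
  have := lv_best LV (a - b) n0; rewrite natrB ?(ltnW ij)// rmorphB/= => h.
  have [h'|h'] := leP 0 ((j%:R - i%:R) * tau - (a%:~R - b%:~R)).
    rewrite ger0_norm// in h; left; apply: (orbit_le _ CF).
    by rewrite rmorphB/= natrD; lra.
  rewrite ltr0_norm// in h; right; apply: (orbit_le _ CF).
  by rewrite rmorphB/= natrD; lra.
(* The translate by 1 of the interval of index 0 starts at [y + 1]; not overlapping it forces the
   other intervals to end before. *)
have v_le i : (i < q')%N -> v i <= y + 1.
  move=> iq; have [->|i0] := eqVneq i 0%N.
    have := return_map_lt_add1 y; have := u_itv 0%N.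
    rewrite /v /u /= => /andP[h1 h2].
    have -> : (k 0%N)%:~R = 0 :> R by rewrite kR /= subrr floor0 oppr0.
    by lra.
  have [] := dis 0%N i 1 (k i) (leq_ltn_trans (leq0n i) iq) iq.
  - by rewrite eq_sym.
  - rewrite add0n; have := u_itv i; rewrite -/(u i) rmorphB/=.
    by have := return_map_gt y; rewrite /return_map; lra.
  - by rewrite vE.
have -> : P = Phi (y + 1) - Phi y by rewrite (dl_add1 DL); ring.
rewrite -(big_mkord xpredT (fun i => Phi (iter i F (g y)) - Phi (iter i F y))).
under eq_bigr => i _ do rewrite -(Phi_addz _ (k i)) -/(v i) -/(u i).
apply: sum_disjoint_increments; first exact: (dl_le DL).
- by lra.
- exact: iota_uniq.
- move=> i; rewrite mem_index_iota => /andP[_ iq].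
  by split; [case/andP: (u_itv i)|exact: u_v|exact: v_le].
- move=> i j; rewrite !mem_index_iota => /andP[_ iq] /andP[_ jq] ij.
  by rewrite !vE; exact: dis.
Qed.

Lemma sum_return_increments_iter m x :
  \sum_(i < m * q') (Phi (iter i F (g x)) - Phi (iter i F x)) <= m%:R * P.
Proof.
elim: m => [|m IH] in x *; first by rewrite mul0n big_ord0 mul0r.
rewrite mulSn big_split_ord /= -natr1 mulrDl mul1r addrC; apply: lerD.
  under eq_bigr => i _ do rewrite addnC !iterD return_map_iter.
  exact: IH.
exact: sum_return_increments.
Qed.

(* [x, g (g (g x))] consists of three fundamental domains of [g] and [3 * q']
   iterates of each of them cover the circle at most three times. *)
Lemma cross_ratio_iter m x a b c d : (m <= 3 * q')%N ->
  x <= a -> a < b -> b < c -> c < d -> d <= g (g (g x)) ->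
  cross_ratio (iter m F a) (iter m F b) (iter m F c) (iter m F d) <=
  expR (9 * P) * cross_ratio a b c d.
Proof.
move=> mq xa ab bc cd dx.
(* The factors of the single iterates multiply, so the increments of [Phi] add up in the
   exponent. *)
have step n : cross_ratio (iter n F a) (iter n F b) (iter n F c) (iter n F d) <=
    expR (\sum_(i < n) (Phi (iter i F d) - Phi (iter i F a))) * cross_ratio a b c d.
  elim: n => [|n IH]; first by rewrite big_ord0 expR0 mul1r.
  rewrite big_ord_recr/= addrC expRD -mulrA.
  apply: le_trans (dl_step DL _ _ _) _; [exact: iter_lt..|].
  by rewrite ler_pM2l ?expR_gt0.
apply: (le_trans (step m)); rewrite ler_wpM2r ?cross_ratio_ge0// ler_expR.
pose f i := Phi (iter i F (g (g (g x)))) - Phi (iter i F x).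
have f0 i : 0 <= f i.
  rewrite /f subr_ge0 (dl_le DL)// iter_le//.
  by have := return_map_gt x; have := return_map_gt (g x);
     have := return_map_gt (g (g x)); lra.
apply: (@le_trans _ _ (\sum_(i < m) f i)).
  by apply: ler_sum => i _; apply: lerB; apply: (dl_le DL); apply: iter_le.
apply: (@le_trans _ _ (\sum_(i < 3 * q') f i)).
  rewrite -(subnKC mq) big_split_ord/= lerDl.
  by apply: sumr_ge0 => i _.
have fE i : f i = (Phi (iter i F (g (g (g x)))) - Phi (iter i F (g (g x)))) +
  ((Phi (iter i F (g (g x))) - Phi (iter i F (g x))) +
   (Phi (iter i F (g x)) - Phi (iter i F x))) by rewrite /f; ring.
under eq_bigr => i _ do rewrite fE.
have := sum_return_increments_iter 3 x.
have := sum_return_increments_iter 3 (g x).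
have := sum_return_increments_iter 3 (g (g x)).
by rewrite !big_split/=; lra.
Qed.

End OneLevel.
End Levels.

(** * Comparable adjacent fundamental domains *)

Section BoundedGeometry.
Variable R : realType.
Implicit Types x y z t : R.
Variables (F : R -> R) (tau : R) (Phi : R -> R) (P : R).
Hypothesis DL : distortion_lift F tau Phi P.
Variables (q q' : nat) (p p' : int).
Hypothesis LV : level tau q q' p p'.

Let CF := dl_map DL.
Let F_addz := iter_addz (clm_add1 CF).

Local Notation g := (return_map F q p).
Local Notation g' := (return_map F q' p').
Local Notation B := (expR (9 * P)).

Let g_gt := return_map_gt DL LV.
Let g'_lt := return_map_next_lt DL LV.
Let g_lt x y : x < y -> g x < g y := @return_map_lt _ _ _ _ _ DL q p x y.
Let g_le x y : x <= y -> g x <= g y := @return_map_le _ _ _ _ _ DL q p x y.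

Let P_ge0 : 0 <= P.
Proof.
have -> : P = Phi (0 + 1) - Phi 0 by rewrite (dl_add1 DL); ring.
by rewrite subr_ge0 (dl_le DL)//; lra.
Qed.

Let B_ge1 : 1 <= B.
Proof. by rewrite -expR0 ler_expR mulr_ge0. Qed.

Lemma return_map_min : exists z, forall x, g z - z <= g x - x.
Proof.
have cg : {within `[0, 1], continuous (fun x => g x - x)}.
  apply: continuous_subspaceT => t; apply: cvgB; last exact: cvg_id.
  by apply: cvgB; [exact: (iter_continuous CF)|exact: cvg_cst].
have [c _ Hc] := EVT_min ler01 cg; exists c => x.
have := Hc (x - (Num.floor x)%:~R).
rewrite in_itv/=; have /andP[] := floor_itv x; rewrite intrD1 => fl1 fl2.
rewrite -rmorphN/= (return_map_addz DL) rmorphN/=.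
by move=> /(_ ltac:(lra)); lra.
Qed.

Lemma return_map_cofinal y z : exists m : nat, z <= iter m g y.
Proof.
have [c dmin] := return_map_min.
have dc : 0 < g c - c by rewrite subr_gt0 g_gt.
have Hm m : y + m%:R * (g c - c) <= iter m g y.
  elim: m => [|m IH] /=; first by rewrite mul0r addr0.
  by have := dmin (iter m g y); rewrite -natr1 mulrDl mul1r; lra.
pose m := (Num.truncn (`|z - y| / (g c - c))).+1.
have zm : `|z - y| / (g c - c) < m%:R.
  have z0 : 0 <= `|z - y| / (g c - c) by rewrite divr_ge0// ltW.
  by have /andP[] := truncn_itv z0.
exists m; apply: le_trans (Hm m).
rewrite ltr_pdivrMr// in zm; have := ler_norm (z - y); lra.
Qed.

Lemma orbit_meets_fundamental_domain x z : exists (i : nat) (k : int),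
  (i < q + q')%N /\ z <= iter i F x + k%:~R < g z.
Proof.
pose good i := exists k : int, z <= iter i F x + k%:~R < g z.
(* Starting from the last integer translate of [x] not beyond [z], the first iterate of [g] that
   reaches [z] is still before [g z]. *)
have [i0 gi0] : exists i, good i.
  pose j := Num.floor (z - x).
  have /andP[] := floor_itv (z - x); rewrite intrD1 -/j => h1 h2.
  have gE m : exists k : int, iter m g (x + j%:~R) = iter (m * q) F x + k%:~R.
    elim: m => [|m [k IH]]; first by exists j; rewrite mul0n.
    exists (k - p) => /=; rewrite IH {1}/return_map F_addz -iterD mulSn.
    by rewrite rmorphB/=; ring.
  case: (ex_minnP (return_map_cofinal (x + j%:~R) z)) => -[|n] zn nmin.
    exists 0%N, j; apply/andP; split=> //=.
    by apply: le_lt_trans (g_gt z); lra.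
  have [k e] := gE n.+1.
  exists (n.+1 * q)%N, k; rewrite -e zn/=; apply: g_lt.
  by rewrite ltNge; apply/negP => /nmin; rewrite ltnn.
(* In a first visit at time [i >= q + q'], the point [g'^-1] of the orbit, or
   else [(g \o g')^-1] of it, would be an earlier visit. *)
have ex : exists i, `[< good i >] by exists i0; exact/asboolP.
case: (ex_minnP ex) => i /asboolP[k /andP[zt tz]] imin.
exists i, k; split; last by rewrite zt.
rewrite ltnNge; apply/negP => qi.
pose r := (i - (q + q'))%N.
have ir : i = (q' + (q + r))%N by rewrite /r; lia.
have no j l : (j < i)%N -> z <= iter j F x + l%:~R -> iter j F x + l%:~R < g z ->
    False.
  move=> ji zj jz; have /imin : `[< good j >].
    by apply/asboolP; exists l; rewrite zj.
  by rewrite leqNgt ji.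
pose w := iter r F x + (k + p' + p)%:~R.
pose s := iter (q + r) F x + (k + p')%:~R.
have sw : s = g w.
  by rewrite /s /w /return_map F_addz -iterD !rmorphD/=; ring.
have ts : iter i F x + k%:~R = g' s.
  by rewrite /s /return_map F_addz -iterD ir !rmorphD/=; ring.
have st : iter i F x + k%:~R < s by rewrite ts; exact: g'_lt.
have [q0 qq] := (lv_gt0 LV, lv_le LV).
have [sz|zs] := ltP s (g z).
  by apply: (no (q + r)%N (k + p')) => //; [lia|apply: le_trans (ltW st)].
have zw : z <= w.
  rewrite leNgt; apply/negP => /g_lt; rewrite -sw; lra.
apply: (no r (k + p' + p)) => //; first by lia.
apply: lt_trans tz; rewrite -/w ts sw (return_mapC DL).
exact: (return_map_next_gt DL LV).
Qed.

(* A fundamental domain of minimal length is not longer than its neighbours,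
   so the four end points of three such domains have a cross ratio of at least
   1/4; the cross ratio inequality transports such a bound backwards. *)
Lemma return_map_comparable : exists2 z, forall x, g z - z <= g x - x &
  forall w, g w = z -> z - w <= 4 * B * (g z - z).
Proof.
have [z zmin] := return_map_min.
exists z => // w gw.
have [w' gw'] := return_map_surj DL q p w.
have w'w : w' < w by rewrite -gw' g_gt.
have wz : w < z by rewrite -gw g_gt.
have zgz := g_gt z; have gzggz := g_gt (g z).
have cr : 1 <= (1 + 1) ^+ 2 * cross_ratio w z (g z) (g (g z)).
  by apply: cross_ratio_ge => //; rewrite mul1r; [have := zmin w; lra|exact: zmin].
have m3 : (q <= 3 * q')%N by have := lv_le LV; lia.
have dg : g z <= g (g (g w')) by rewrite gw' gw.
have := cross_ratio_iter DL LV m3 (lexx w') w'w wz zgz dg.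
rewrite -(cross_ratio_add _ _ _ _ (- p%:~R)) -!/(return_map F q p _) gw' gw => h.
have h2 := cross_ratio_le_right w'w wz zgz.
have h3 : 1 <= 4 * B * cross_ratio w' w z (g z) by lra.
have zw : 0 <= z - w by lra.
have h4 : (z - w) * 1 <= (z - w) * (4 * B * cross_ratio w' w z (g z)).
  exact: ler_wpM2l.
have h5 : 4 * B * (cross_ratio w' w z (g z) * (z - w)) <= 4 * B * (g z - z).
  by apply: ler_wpM2l => //; lra.
by lra.
Qed.

(** [B] is the loss along the orbit; [2 + 4 * B] is [1 + K] in [cross_ratio_ge] with
    [K = 1 + 4 * B], the length of two domains around [z] measured by the minimal one. *)
Definition geometry_bound : R := B * (2 + 4 * B) ^+ 2.
Local Notation C := geometry_bound.

Lemma geometry_bound_ge1 : 1 <= C.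
Proof.
have B1 := B_ge1; have h : 1 <= (2 + 4 * B) ^+ 2 by rewrite exprn_ege1//; lra.
by rewrite /C -[leLHS]mulr1; apply: ler_pM.
Qed.

(** Iterate until the image [g y] of [g x] falls into [w, z), where [g w = z] and the domain at [z]
    is minimal. The middle interval [g y, g (g y)] then lies in [w, g z], and the two outer ones are
    at least as long as the minimal domain. *)
Lemma return_map_cross_ratio_ge x : 1 <= C * cross_ratio x (g x) (g (g x)) (g (g (g x))).
Proof.
have [z zmin zw] := return_map_comparable.
have [w gw] := return_map_surj DL q p z.
have [i [k [iq /andP[h1 h2]]]] := orbit_meets_fundamental_domain (g x) w.
have m3 : (i <= 3 * q')%N by have := lv_le LV; lia.
have x1 := g_gt x; have x2 := g_gt (g x); have x3 := g_gt (g (g x)).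
have := cross_ratio_iter DL LV m3 (lexx x) x1 x2 x3 (lexx _).
rewrite -(cross_ratio_add _ _ _ _ k%:~R).
pose y := iter i F x + k%:~R.
have yE : iter i F (g x) + k%:~R = g y.
  by rewrite /y (return_map_addz DL) (return_map_iter DL).
have yE2 : iter i F (g (g x)) + k%:~R = g (g y).
  by rewrite -yE (return_map_addz DL) (return_map_iter DL q p i (g x)).
have yE3 : iter i F (g (g (g x))) + k%:~R = g (g (g y)).
  by rewrite -yE2 (return_map_addz DL) (return_map_iter DL q p i (g (g x))).
rewrite -/y yE yE2 yE3 => h.
rewrite yE gw in h1 h2.
have y1 := g_gt y; have y2 := g_gt (g y); have y3 := g_gt (g (g y)).
have d1 := zmin y; have d2 := zmin (g (g y)).
have yz : g (g y) < g z by apply: g_lt.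
have len : g (g y) - g y <= (1 + 4 * B) * (g z - z).
  by have := zw w gw; lra.
have B1 := B_ge1; have B0 : 0 <= 1 + 4 * B by lra.
have cr := @cross_ratio_ge _ (1 + 4 * B) y (g y) (g (g y)) (g (g (g y))) y1 y2 y3 B0.
have {}cr : 1 <= (1 + (1 + 4 * B)) ^+ 2 * cross_ratio y (g y) (g (g y)) (g (g (g y))).
  by apply: cr; apply: (le_trans len); apply: ler_wpM2l.
apply: (le_trans cr); rewrite /C [leRHS]mulrAC [leRHS]mulrC addrA.
by apply: ler_wpM2l => //; exact: exprn_ge0; lra.
Qed.

Lemma return_map_bounded_geometry x :
  g x - x <= C * (g (g x) - g x) /\ g (g x) - g x <= C * (g x - x).
Proof.
have cr := return_map_cross_ratio_ge.
have C1 := geometry_bound_ge1.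
have H y : g (g y) - g y <= C * (g y - y) /\
           g (g y) - g y <= C * (g (g (g y)) - g (g y)).
  have y1 := g_gt y; have y2 := g_gt (g y); have y3 := g_gt (g (g y)).
  have h1 := cross_ratio_le_left y1 y2 y3.
  have h2 := cross_ratio_le_right y1 y2 y3.
  have e : (g (g y) - g y) * 1 <=
      (g (g y) - g y) * (C * cross_ratio y (g y) (g (g y)) (g (g (g y)))).
    by apply: ler_wpM2l => //; lra.
  move: e h1 h2; set c := cross_ratio _ _ _ _ => e h1 h2.
  have h1' : C * (c * (g (g y) - g y)) <= C * (g y - y) by apply: ler_wpM2l; lra.
  have h2' : C * (c * (g (g y) - g y)) <= C * (g (g (g y)) - g (g y)).
    by apply: ler_wpM2l; lra.
  by split; lra.
have [w gw] := return_map_surj DL q p x.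
by split; [case: (H w); rewrite gw|case: (H x)].
Qed.

End BoundedGeometry.

(** * Two successive levels along a critical orbit *)

Section CriticalScale.
Variable R : realType.
Implicit Types x y z t r m : R.
Variables (F : R -> R) (tau : R) (Phi : R -> R) (P : R).
Hypothesis DL : distortion_lift F tau Phi P.
Variables (q q' : nat) (p p' : int).
Hypothesis LV : level tau q q' p p'.

Let CF := dl_map DL.
Let F_lt := clm_lt CF.
Let F_add1 := clm_add1 CF.
Let F_addz := iter_addz F_add1.

Local Notation g := (return_map F q p).
Local Notation g' := (return_map F q' p').
Local Notation B := (expR (9 * P)).

Variable C : R.
Hypothesis C_ge1 : 1 <= C.
Hypothesis g_geometry : forall x,
  g x - x <= C * (g (g x) - g x) /\ g (g x) - g x <= C * (g x - x).
Hypothesis g'_geometry : forall x,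
  x - g' x <= C * (g' x - g' (g' x)) /\ g' x - g' (g' x) <= C * (x - g' x).

Let g_gt := return_map_gt DL LV.
Let g'_lt := return_map_next_lt DL LV.
Let g_lt x y : x < y -> g x < g y := @return_map_lt _ _ _ _ _ DL q p x y.
Let g_le x y : x <= y -> g x <= g y := @return_map_le _ _ _ _ _ DL q p x y.
Let g'_lt2 x y : x < y -> g' x < g' y := @return_map_lt _ _ _ _ _ DL q' p' x y.

Let preimage_lt x w : g w = x -> w < g' x.
Proof.
move=> gw; rewrite ltNge; apply/negP => /g_le; rewrite gw.
by have := return_map_next_gt DL LV x; lra.
Qed.

(** The interval [g' x, x] is contained in the fundamental domain of [g] that ends at [x]. *)
Lemma next_scale_le x : x - g' x <= C * (g x - x).
Proof.
have [w gw] := return_map_surj DL q p x.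
have := preimage_lt gw; have [h _] := g_geometry w; rewrite gw in h.
by lra.
Qed.

(** The factors are the losses in [scale_cross_ratio_ge]: two steps of [g'], two adjacent domains of
    [g] against the second one, and four successive domains of [g] against the last one. *)
Definition scale_bound := C ^+ 2 * (1 + C) * (1 + C + C ^+ 2 + C ^+ 3).
Local Notation K := scale_bound.

Lemma scale_bound_ge1 : 1 <= K.
Proof.
have C1 := C_ge1; have C2 : 1 <= C ^+ 2 by exact: exprn_ege1.
have C3 : 1 <= C ^+ 3 by exact: exprn_ege1.
rewrite /scale_bound -[leLHS]mulr1; apply: ler_pM => //; last by lra.
by rewrite -[leLHS]mulr1; apply: ler_pM => //; lra.
Qed.

(** Bounded geometry of [g'] compares [g' x, x] with [g' c, c]. Since a step of [g'] goes back by
    less than one of [g], the interval [g' x, g x] lies within four domains of [g], the last of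
    which starts at [c]. *)
Lemma scale_cross_ratio_ge c x : x = g' (g' c) ->
  c - g' c <= K * (g c - c) * cross_ratio (g' x) x (g x) (g (g x)).
Proof.
move=> xE; have C1 := C_ge1.
have x1 := g'_lt x; have x2 := g_gt x; have x3 := g_gt (g x).
have [w1 gw1] := return_map_surj DL q p c.
have [w2 gw2] := return_map_surj DL q p w1.
have [w3 gw3] := return_map_surj DL q p w2.
have gc := g_gt c; have g'c := g'_lt c; have g'g'c := g'_lt (g' c).
have h1 : c - g' c <= C ^+ 2 * (x - g' x).
  have [a1 _] := g'_geometry c; have [a2 _] := g'_geometry (g' c).
  rewrite -xE in a1 a2.
  have : C * (g' c - x) <= C * (C * (x - g' x)) by apply: ler_wpM2l; lra.
  by lra.
have h2 : g (g x) - x <= (1 + C) * (g (g x) - g x).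
  by have [a1 _] := g_geometry x; lra.
have h3 : g x - g' x <= (1 + C + C ^+ 2 + C ^+ 3) * (g c - c).
  have [a1 _] := g_geometry w1; have [a2 _] := g_geometry w2.
  have [a3 _] := g_geometry w3; rewrite gw1 in a1 *; rewrite gw2 gw1 in a2.
  rewrite gw3 gw2 in a3.
  have b2 : C * (c - w1) <= C * (C * (g c - c)) by apply: ler_wpM2l => //; lra.
  have b3 : C * (w1 - w2) <= C * (C * (C * (g c - c))) by apply: ler_wpM2l => //; lra.
  have xc : g x < g c by apply: g_lt; rewrite xE; lra.
  have e1 : w1 < g' c := preimage_lt gw1.
  have e2 : w2 < g' (g' c) by apply: lt_trans (preimage_lt gw2) _; exact: g'_lt2.
  have e3 : w3 < g' x.
    rewrite xE.
    by apply: lt_trans (preimage_lt gw3) _; apply: g'_lt2.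
  by lra.
rewrite /cross_ratio mulrA ler_pdivlMr; last by rewrite mulr_gt0; lra.
have -> : K * (g c - c) * ((x - g' x) * (g (g x) - g x)) =
  C ^+ 2 * (x - g' x) * (((1 + C + C ^+ 2 + C ^+ 3) * (g c - c)) *
    ((1 + C) * (g (g x) - g x))) by rewrite /scale_bound; ring.
by apply: ler_pM => //; [lra|rewrite mulr_ge0; lra|apply: ler_pM; lra].
Qed.

(** The remaining [2 * q' - a] iterates carry the configuration at [y] to that at [x], up to an
    integer, because the return maps commute with [F]. The four points lie in three domains of [g],
    starting at the preimage of [y]. *)
Lemma scale_cross_ratio_iter c a x y : (a <= 2 * q')%N -> x = g' (g' c) ->
  y = iter a F c ->
  cross_ratio (g' x) x (g x) (g (g x)) <=
  B * cross_ratio (g' y) y (g y) (g (g y)).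
Proof.
move=> aq -> yE.
have [w gw] := return_map_surj DL q p y.
have m3 : (2 * q' - a <= 3 * q')%N by lia.
have y1 := g'_lt y; have y2 := g_gt y; have y3 := g_gt (g y).
have wy : w <= g' y by apply/ltW/preimage_lt.
have dy : g (g y) <= g (g (g w)) by rewrite gw.
have := cross_ratio_iter DL LV m3 wy y1 y2 y3 dy.
have E z : iter (2 * q' - a) F (iter a F z) + (- (p' + p'))%:~R = g' (g' z).
  rewrite -iterD subnK// mul2n -addnn iterD /return_map -[in RHS]rmorphN/= F_addz.
  by rewrite !rmorphN rmorphD/=; ring.
rewrite -(cross_ratio_add _ _ _ _ (- (p' + p'))%:~R).
have g'y : g' y = iter a F (g' c) by rewrite yE (return_map_iter DL).
have gy : g y = iter a F (g c) by rewrite yE (return_map_iter DL).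
have ggy : g (g y) = iter a F (g (g c)) by rewrite gy (return_map_iter DL q p a (g c)).
rewrite {1}g'y {1}gy {1}ggy [in iter _ F y]yE !E.
have C1 := return_mapC DL q' p' q p.
by rewrite !C1.
Qed.

(* If [r = c - g' c] were much smaller than [m = g c - c], then the cross ratio
   at time 1, just after the critical point, would be much smaller than
   [r / m], while at time [2 * q'] it is of order [r / m] again: this
   contradicts the cross ratio inequality. *)
Lemma critical_scale e c : 0 < e ->
  (forall r m, 0 < r -> 0 < m -> m <= 1 -> r <= e * m ->
    (F c - F (c - r)) * m <= (2 * (B * K))^-1 * r * (F (c + m) - F c)) ->
  forall a y, (a <= 2 * q')%N -> y = iter a F c ->
  e * (g y - y) <= B * K * (y - g' y).
Proof.
move=> e0 asym a y aq yE; have K1 := scale_bound_ge1.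
have B0 : 0 < B by exact: expR_gt0.
have BK0 : 0 < B * K by rewrite mulr_gt0//; lra.
have g'c := g'_lt c; have gc := g_gt c; have ggc := g_gt (g c).
have gc1 := return_map_lt_add1 DL LV c.
have := scale_cross_ratio_ge (erefl (g' (g' c))); set S := cross_ratio _ _ _ _ => hS.
have er : e * (g c - c) < c - g' c.
  (* The factor [B * K] lost on the way is compensated by the constant in [asym], whose extra 2
     leaves a positive quantity bounded by its own half. *)
  rewrite ltNge; apply/negP => re.
  have := asym (c - g' c) (g c - c).
  have -> : c - (c - g' c) = g' c by ring.
  have -> : c + (g c - c) = g c by ring.
  have m1 : g c - c <= 1 by lra.
  move=> /(_ ltac:(lra) ltac:(lra) m1 re) h.
  have q'0 : (1 <= 2 * q')%N by have := lv_gt0 LV; have := lv_le LV; lia.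
  have hS1 := scale_cross_ratio_iter q'0 (erefl (g' (g' c))) (erefl (iter 1 F c)).
  rewrite /= -/S in hS1.
  have F1 : F (g' c) < F c by exact: F_lt.
  have F2 : F c < F (g c) by exact: F_lt.
  have F3 : F (g c) < F (g (g c)) by exact: F_lt.
  have E1 := return_map_iter DL q' p' 1 c; have E2 := return_map_iter DL q p 1 c.
  have E3 := return_map_iter DL q p 1 (g c).
  rewrite /= in E1 E2 E3; rewrite E2 in E3.
  rewrite -E3 -E1 -E2 in hS1.
  have h2 := cross_ratio_le_left F1 F2 F3.
  move: hS1 h2; set cr := cross_ratio (F _) _ _ _ => hS1 h2.
  have m0 : 0 < g c - c by lra.
  have F20 : 0 < F (g c) - F c by lra.
  have k1 : K * (g c - c) * S <= K * (g c - c) * (B * cr).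
    by apply: ler_wpM2l => //; rewrite mulr_ge0; lra.
  have k2 : (c - g' c) * (F (g c) - F c) <=
      K * (g c - c) * (B * cr) * (F (g c) - F c) by apply: ler_wpM2r; lra.
  have k3 : B * K * (g c - c) * (cr * (F (g c) - F c)) <=
      B * K * (g c - c) * (F c - F (g' c)).
    by apply: ler_wpM2l => //; rewrite mulr_ge0; lra.
  have k4 : B * K * ((F c - F (g' c)) * (g c - c)) <=
      B * K * ((2 * (B * K))^-1 * (c - g' c) * (F (g c) - F c)).
    by apply: ler_wpM2l => //; lra.
  have k5 : B * K * ((2 * (B * K))^-1 * (c - g' c) * (F (g c) - F c)) =
     (c - g' c) * (F (g c) - F c) / 2.
    by field; rewrite !gt_eqF//; lra.
  have k6 : 0 < (c - g' c) * (F (g c) - F c) by rewrite mulr_gt0; lra.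
  by lra.
(* So the cross ratio at time [2 * q'] is at least [e / K], and up to the factor [B] this passes to
   every earlier time [a]. *)
have eS : e <= K * S.
  have h : e * (g c - c) <= K * S * (g c - c) by lra.
  by rewrite ler_pM2r// in h; lra.
have y1 := g'_lt y; have y2 := g_gt y; have y3 := g_gt (g y).
have h2 := cross_ratio_le_left y1 y2 y3.
have h1 := scale_cross_ratio_iter aq (erefl (g' (g' c))) yE; rewrite -/S in h1.
have k1 : K * S <= K * (B * cross_ratio (g' y) y (g y) (g (g y))).
  by apply: ler_wpM2l => //; lra.
have k2 : e * (g y - y) <= K * (B * cross_ratio (g' y) y (g y) (g (g y))) * (g y - y).
  by apply: ler_wpM2r; lra.
have k3 : B * K * (cross_ratio (g' y) y (g y) (g (g y)) * (g y - y)) <=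
   B * K * (y - g' y) by apply: ler_wpM2l => //; lra.
by lra.
Qed.

End CriticalScale.

(** * Bounds at all levels, of either parity *)

Section RealBounds.
Variable R : realType.
Implicit Types x y : R.

Lemma iter_opp (F : R -> R) n x :
  iter n (fun x => - F (- x)) x = - iter n F (- x).
Proof. by elim: n => [|n /= ->]; rewrite ?opprK. Qed.

Lemma return_map_opp (F : R -> R) n (k : int) x :
  return_map (fun x => - F (- x)) n (- k) x = - return_map F n k (- x).
Proof. by rewrite /return_map iter_opp rmorphN/= opprK opprB addrC. Qed.

Lemma critical_lift_distortion (F F1 F2 F3 : R -> R) tau :
  critical_lift F F1 F2 F3 -> circle_lift_map F tau ->
  exists Phi P, distortion_lift F tau Phi P.
Proof.
move=> FL CF; have [Phi [P [Phi_le Phi_add1 step]]] := cross_ratio_step FL.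
exists Phi, P; split=> // a b c d ab bc cd.
have Fab := lift_lt FL ab; have Fbc := lift_lt FL bc; have Fcd := lift_lt FL cd.
rewrite /cross_ratio ler_pdivrMr; last by rewrite mulr_gt0; lra.
rewrite mulrA mulrAC ler_pdivlMr; last by rewrite mulr_gt0; lra.
have := step a b c d ab bc cd; rewrite /cross_le => h.
by apply: (le_trans h); rewrite !mulrA.
Qed.

Variables (F F1 F2 F3 : R -> R) (rho : R).
Hypothesis FL : critical_lift F F1 F2 F3.
Hypothesis CF : circle_lift_map F rho.
Hypothesis rho_gt0 : 0 < rho.
Hypothesis rho_lt1 : rho < 1.

Let rho_irr n (k : int) : (0 < n)%N -> n%:R * rho != k%:~R :=
  @translation_irrational R F rho n k CF.

Local Notation q := (cf_denom rho).
Local Notation p := (cf_num rho).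

Definition closest_return n x := return_map F (q n) (p n)%:Z x.
Local Notation G := closest_return.
Definition return_length n x := `|G n x - x|.
Local Notation D := return_length.

Lemma level_even n : ~~ odd n ->
  level rho (q n) (q n.+1) (p n)%:Z (p n.+1)%:Z.
Proof.
move=> on; have := cf_error_sign rho_gt0 rho_lt1 rho_irr n.
rewrite -signr_odd (negbTE on) expr0 mul1r => /andP[e0 e1].
have eS := cf_errorS rho_gt0 rho_lt1 rho_irr n.
have /andP[t0 t1] := gauss_iter_itv rho_gt0 rho_lt1 rho_irr n.+1.
have t : 0 < iter n.+1 (@gauss R) rho * cf_error rho n < cf_error rho n.
  by rewrite mulr_gt0//= gtr_pMl.
split.
- exact: cf_denom_gt0.
- exact: cf_denom_leS.
- by rewrite -!pmulrn -/(cf_error rho n) e0.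
- rewrite -!pmulrn -/(cf_error rho n) -/(cf_error rho n.+1) eS; lra.
- move=> j k jq; rewrite -pmulrn -/(cf_error rho n) -(gtr0_norm e0).
  exact: cf_best_approx.
Qed.

Lemma level_odd n : odd n ->
  level (- rho) (q n) (q n.+1) (- (p n)%:Z) (- (p n.+1)%:Z).
Proof.
move=> on; have := cf_error_sign rho_gt0 rho_lt1 rho_irr n.
rewrite -signr_odd on expr1 mulN1r => /andP[e0 e1].
have eS := cf_errorS rho_gt0 rho_lt1 rho_irr n.
have /andP[t0 t1] := gauss_iter_itv rho_gt0 rho_lt1 rho_irr n.+1.
have t : 0 < iter n.+1 (@gauss R) rho * - cf_error rho n < - cf_error rho n.
  by rewrite mulr_gt0//= gtr_pMl.
have E m : (q m)%:R * - rho - (- (p m)%:Z)%:~R = - cf_error rho m.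
  by rewrite rmorphN/= mulrN /cf_error -!pmulrn; ring.
split.
- exact: cf_denom_gt0.
- exact: cf_denom_leS.
- by rewrite E e0.
- by rewrite !E eS; lra.
- move=> j k jq; rewrite E -(gtr0_norm e0) normrN.
  have -> : j%:R * - rho - k%:~R = - (j%:R * rho - (- k)%:~R).
    by rewrite rmorphN/=; ring.
  by rewrite normrN; exact: cf_best_approx.
Qed.

Lemma closest_return_opp n x :
  return_map (fun x => - F (- x)) (q n) (- (p n)%:Z) (- x) = - G n x.
Proof. by rewrite return_map_opp opprK. Qed.

Lemma closest_return_ltE n x : if odd n then G n x < x else x < G n x.
Proof.
have [Phi [P DL]] := critical_lift_distortion FL CF.
case: ifPn => on; last exact: (return_map_gt DL (level_even on) x).
have := return_map_gt (distortion_lift_opp DL) (level_odd on) (- x).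
by rewrite closest_return_opp ltrN2.
Qed.

Lemma return_lengthE n x : D n x = if odd n then x - G n x else G n x - x.
Proof.
have := closest_return_ltE n x; rewrite /D; case: ifP => _ h.
  by rewrite ltr0_norm; lra.
by rewrite gtr0_norm; lra.
Qed.

Lemma return_length_gt0 n x : 0 < D n x.
Proof.
by have := closest_return_ltE n x; rewrite return_lengthE; case: ifP => _; lra.
Qed.

Lemma return_length_lt1 n x : D n x < 1.
Proof.
have [Phi [P DL]] := critical_lift_distortion FL CF.
rewrite return_lengthE; case: ifPn => on.
  have := return_map_lt_add1 (distortion_lift_opp DL) (level_odd on) (- x).
  by rewrite closest_return_opp; lra.
by have := return_map_lt_add1 DL (level_even on) x; rewrite -/(G n x); lra.
Qed.

Lemma return_length_geometry : exists2 C, 1 <= C & forall n x,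
  D n x <= C * D n (G n x) /\ D n (G n x) <= C * D n x.
Proof.
have [Phi [P DL]] := critical_lift_distortion FL CF.
exists (geometry_bound P); first exact: (geometry_bound_ge1 DL).
move=> n x; rewrite !return_lengthE; case: ifPn => on.
  have := return_map_bounded_geometry (distortion_lift_opp DL) (level_odd on) (- x).
  rewrite !closest_return_opp.
  have E a b : - a - - b = b - a :> R by ring.
  by rewrite !E.
exact: (return_map_bounded_geometry DL (level_even on) x).
Qed.

Lemma critical_return_length c : F1 c = 0 -> exists2 C, 1 <= C &
  forall n a, (a <= 2 * q n.+1)%N ->
  D n (iter a F c) <= C * D n.+1 (iter a F c) /\
  D n.+1 (iter a F c) <= C * D n (iter a F c).
Proof.
move=> F1c; have [Phi [P DL]] := critical_lift_distortion FL CF.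
have [C C1 HC] := return_length_geometry.
pose BK := expR (9 * P) * scale_bound C.
have BK0 : 0 < BK by rewrite mulr_gt0 ?expR_gt0//; have := scale_bound_ge1 C1; lra.
have eta0 : 0 < (2 * BK)^-1 by rewrite invr_gt0; lra.
have [e e0 asym] := critical_asymmetry FL F1c eta0.
have BKe : 0 < BK / e by rewrite divr_gt0.
(* [C] bounds the next length by the present one, [BK / e] the present one by the next. *)
exists (C + BK / e); first by lra.
move=> n a aq; set y := iter a F c.
suff [h1 h2] : e * D n y <= BK * D n.+1 y /\ D n.+1 y <= C * D n y.
  have d0 := return_length_gt0 n y; have d1 := return_length_gt0 n.+1 y.
  split; last first.
    by apply: (le_trans h2); rewrite ler_pM2r//; lra.
  apply: (@le_trans _ _ (BK / e * D n.+1 y)); last by rewrite ler_pM2r//; lra.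
  by rewrite mulrAC ler_pdivlMr// mulrC.
have HCn x := HC n x; have HCS x := HC n.+1 x.
move: (HCn) (HCS) => HCn' HCS'.
rewrite !return_lengthE/=; case: ifPn => on /=.
  have DL' := distortion_lift_opp DL; have LV := level_odd on.
  have E a' b : - a' - - b = b - a' :> R by ring.
  have g1 x : let g := return_map (fun x => - F (- x)) (q n) (- (p n)%:Z) in
      g x - x <= C * (g (g x) - g x) /\ g (g x) - g x <= C * (g x - x).
    lazy zeta; rewrite -[x]opprK; move: (- x) => z; rewrite !closest_return_opp !E.
    by have := HCn z; rewrite !return_lengthE on.
  have g2 x : let g' := return_map (fun x => - F (- x)) (q n.+1) (- (p n.+1)%:Z) in
      x - g' x <= C * (g' x - g' (g' x)) /\ g' x - g' (g' x) <= C * (x - g' x).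
    lazy zeta; rewrite -[x]opprK; move: (- x) => z; rewrite !closest_return_opp !E.
    by have := HCS z; rewrite !return_lengthE /= on.
  have := next_scale_le DL' LV g1 (- y).
  rewrite !closest_return_opp !E => h2; split=> //.
  have := @critical_scale _ _ _ _ _ DL' _ _ _ _ LV C C1 g1 g2 e (- c) e0 _ a (- y) aq _.
  rewrite !closest_return_opp !E; apply.
    (* Under the reflection, the inequality needed at [- c] is the second one of
       [critical_asymmetry] at [c]. *)
    move=> r m r0 m0 m1 rm; have [_] := asym r m r0 m0 m1 rm.
    have -> : - (- c - r) = c + r by ring.
    have -> : - (- c + m) = c - m by ring.
    by rewrite !opprK -/BK ![- _ + _]addrC.
  by rewrite iter_opp opprK.
have LV := level_even on.
have g1 x : let g := return_map F (q n) (p n)%:Z in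
    g x - x <= C * (g (g x) - g x) /\ g (g x) - g x <= C * (g x - x).
  by have := HCn x; rewrite !return_lengthE (negbTE on).
have g2 x : let g' := return_map F (q n.+1) (p n.+1)%:Z in
    x - g' x <= C * (g' x - g' (g' x)) /\ g' x - g' (g' x) <= C * (x - g' x).
  by have := HCS x; rewrite !return_lengthE /= on.
split; last exact: (next_scale_le DL LV g1 y).
apply: (critical_scale DL LV C1 g1 g2 e0 _ aq (erefl _)) => r m r0 m0 m1 rm.
by have [] := asym r m r0 m0 m1 rm.
Qed.

End RealBounds.

(** * From the line to the circle *)

Section CircleArcs.
Variable R : realType.
Implicit Types (a b s t u v : R) (x y z : circle R).

Lemma circle_projP u v : circle_proj u = circle_proj v <-> u - v \is a Num.int.
Proof.
rewrite /circle_proj; split; first by move=> /eqmodP.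
by move=> h; apply/eqmodP.
Qed.

Lemma circle_reprK x : circle_proj (repr x) = x.
Proof. exact: reprK. Qed.

Lemma circle_proj_addz u (k : int) : circle_proj (u + k%:~R) = circle_proj u.
Proof. by apply/circle_projP; rewrite addrAC subrr add0r intr_int. Qed.

Lemma circle_proj_eq u v : circle_proj u = circle_proj v ->
  exists k : int, u = v + k%:~R.
Proof. by move=> /circle_projP/intrP[k e]; exists k; rewrite -e; ring. Qed.

Lemma circle_repr_proj u : exists k : int, repr (circle_proj u) = u + k%:~R.
Proof. by apply: circle_proj_eq; rewrite circle_reprK. Qed.

Lemma circle_proj_continuous : continuous (@circle_proj R).
Proof. exact: pi_continuous. Qed.

Lemma frac_part_addz u (k : int) : frac_part (u + k%:~R) = frac_part u.
Proof.
rewrite /frac_part floorDrz ?intr_int// intrKfloor intrD; ring.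
Qed.

Lemma frac_part_id u : 0 <= u < 1 -> frac_part u = u.
Proof.
move=> u01; rewrite /frac_part (_ : Num.floor u = 0) ?subr0//.
by apply: floor_def; rewrite add0r.
Qed.

Lemma circle_dist_proj u v : `|u - v| < 2^-1 ->
  circle_dist (circle_proj u) (circle_proj v) = `|u - v|.
Proof.
move=> h; rewrite /circle_dist.
have [k ->] := circle_repr_proj u; have [l ->] := circle_repr_proj v.
have -> : u + k%:~R - (v + l%:~R) = u - v + (k - l)%:~R by rewrite rmorphB/=; ring.
rewrite frac_part_addz /=; have [uv|uv] := leP v u.
  have h' : u - v < 2^-1 by rewrite ger0_norm// in h; lra.
  rewrite frac_part_id; last by lra.
  by rewrite ger0_norm; [apply/min_idPl|]; lra.
have h' : v - u < 2^-1 by rewrite ltr0_norm// in h; lra.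
have -> : u - v = u - v + 1 + (-1)%:~R by rewrite rmorphN/=; ring.
rewrite frac_part_addz frac_part_id; last by lra.
rewrite rmorphN/= addrK ltr0_norm; last by lra.
by rewrite (min_idPr _); lra.
Qed.

Definition arc a b : set (circle R) := @circle_proj R @` `[a, b]%classic.

Lemma in_arc a b u : arc a b (circle_proj u) <->
  exists k : int, a <= u + k%:~R <= b.
Proof.
split=> [[t /=]|[k uk]].
  rewrite in_itv/= => tab /circle_proj_eq[k e].
  by exists k; rewrite -e.
exists (u + k%:~R); last exact: circle_proj_addz.
by rewrite /= in_itv.
Qed.

Lemma arc_addz a b (k : int) : arc (a + k%:~R) (b + k%:~R) = arc a b.
Proof.
apply/seteqP; split=> x; rewrite -(circle_reprK x) => /in_arc[l h];
  apply/in_arc.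
  by exists (l - k); rewrite rmorphB/=; lra.
by exists (l + k); rewrite rmorphD/=; lra.
Qed.

Lemma circle_arcE u v : u <= v -> v < u + 1 ->
  circle_arc (circle_proj u) (circle_proj v) = arc u v.
Proof.
move=> uv vu; rewrite /circle_arc.
have [k ->] := circle_repr_proj u; have [l ->] := circle_repr_proj v.
have -> : v + l%:~R - (u + k%:~R) = v - u + (l - k)%:~R by rewrite rmorphB/=; ring.
rewrite frac_part_addz frac_part_id; last by lra.
have -> : u + k%:~R + (v - u) = v + k%:~R by ring.
by rewrite -/(arc _ _) arc_addz.
Qed.

(** A proper arc determines its end points: if an end of the second arc were interior to [a, b],
    points just beyond it would belong to the first arc only. *)
Lemma arc_endpointE a b x : b < a + 1 -> arc_endpoint (arc a b) x ->
  x = circle_proj a \/ x = circle_proj b.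
Proof.
move=> ba [a' [b' [ab' ba' e []]]] ->; have {}e : arc a b = arc a' b' by [].
  have : arc a b (circle_proj a') by rewrite e; apply/in_arc; exists 0; lra.
  move=> /in_arc[k]; rewrite le_eqVlt => /andP[/orP[/eqP e'|lt1] le1].
    by left; rewrite e' circle_proj_addz.
  (* Such a [t] lies in [a, b] but in the gap between two consecutive lifts of the second arc. *)
  have [t [t1 t2 t3]] : exists t, [/\ Num.max a (b' + k%:~R - 1) < t,
      t < a' + k%:~R & b' + k%:~R - 1 < t].
    pose m := Num.max a (b' + k%:~R - 1).
    have m1 : m < a' + k%:~R by rewrite gt_max lt1/=; lra.
    have m2 : b' + k%:~R - 1 <= m by rewrite le_max lexx orbT.
    by exists ((m + (a' + k%:~R)) / 2); split; rewrite -?/m; lra.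
  have at_ : a < t by apply: le_lt_trans t1; rewrite le_max lexx.
  have : arc a b (circle_proj t) by apply/in_arc; exists 0; lra.
  rewrite e => /in_arc[j /andP[j1 j2]].
  have jk : 0 < (j + k)%:~R :> R by rewrite rmorphD/=; lra.
  have jk1 : 1 <= (j + k)%:~R :> R by move: jk; rewrite ltr0z gtz0_ge1 -(ler_int R).
  by exfalso; rewrite rmorphD/= in jk1; lra.
have : arc a b (circle_proj b') by rewrite e; apply/in_arc; exists 0; lra.
move=> /in_arc[k /andP[le1]]; rewrite le_eqVlt => /orP[/eqP e'|lt1].
  by right; rewrite -e' circle_proj_addz.
have [t [t1 t2 t3]] : exists t, [/\ t < Num.min b (a' + k%:~R + 1),
    b' + k%:~R < t & t < a' + k%:~R + 1].
  pose m := Num.min b (a' + k%:~R + 1).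
  have m1 : b' + k%:~R < m by rewrite lt_min lt1/=; lra.
  have m2 : m <= a' + k%:~R + 1 by rewrite ge_min lexx orbT.
  by exists ((m + (b' + k%:~R)) / 2); split; rewrite -?/m; lra.
have bt : t < b by apply: (lt_le_trans t1); rewrite ge_min lexx.
have : arc a b (circle_proj t) by apply/in_arc; exists 0; lra.
rewrite e => /in_arc[j /andP[j1 j2]].
have jk : (j + k)%:~R < 0 :> R by rewrite rmorphD/=; lra.
have jk1 : (j + k)%:~R <= -1 :> R.
  have -> : -1 = (-1)%:~R :> R by rewrite rmorphN.
  by move: jk; rewrite ltrz0 ler_int -ltzD1 addNr.
by exfalso; rewrite rmorphD/= in jk1; lra.
Qed.

(** With [a] in [0, 1), the arc meets the fundamental domain in one interval if [b < 1], and in two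
    pieces, around 0 and before 1, otherwise. *)
Lemma arc_length_arc a b : a <= b -> b < a + 1 -> arc_length (arc a b) = b - a.
Proof.
wlog a01 : a b / 0 <= a < 1.
  move=> W ab ba; pose k := - Num.floor a.
  have kR : k%:~R = - (Num.floor a)%:~R :> R by rewrite rmorphN.
  have /andP[] := floor_itv a; rewrite intrD1 => h1 h2.
  rewrite -(arc_addz a b k) W; rewrite ?kR; lra.
move=> ab ba; rewrite /arc_length.
have int01 (k : int) t : 0 <= t < 1 -> a <= t + k%:~R <= b -> k = 0 \/ k = 1.
  move=> t01 tk; have k1 : (-1)%:~R < k%:~R :> R by rewrite rmorphN/=; lra.
  have k2 : k%:~R < 2%:~R :> R by lra.
  by move: k1 k2; rewrite !ltr_int; lia.
have [b1|b1] := ltP b 1.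
  have -> : `[0, 1[%classic `&` @circle_proj R @^-1` arc a b = `[a, b]%classic.
    apply/seteqP; split=> t /=; rewrite !in_itv/=.
      move=> [t01 /in_arc[k tk]]; have [k0|k1] := int01 k t t01 tk.
        by rewrite k0 in tk; lra.
      by rewrite k1 in tk; lra.
    by move=> tab; split; [lra|apply/in_arc; exists 0; lra].
  rewrite lebesgue_measure_itv/= lte_fin; case: ltP => [//|ba'].
  by rewrite /=; lra.
have -> : `[0, 1[%classic `&` @circle_proj R @^-1` arc a b =
    `[0, b - 1]%classic `|` `[a, 1[%classic.
  apply/seteqP; split=> t /=; rewrite !in_itv/=.
    move=> [t01 /in_arc[k tk]]; have [k0|k1] := int01 k t t01 tk.
      by right; rewrite k0 in tk; lra.
    by left; rewrite k1 in tk; lra.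
  move=> [t01|t01]; split; try lra; apply/in_arc; [exists 1|exists 0]; lra.
rewrite measureU//=; last first.
  by apply/seteqP; split=> t //=; rewrite !in_itv/=; lra.
rewrite !lebesgue_measure_itv/= !lte_fin.
case: ltP => h1; case: ltP => h2 /=; lra.
Qed.

End CircleArcs.

(** Otherwise the intermediate value theorem yields the value of an integer plus 1/2. This serves to
    compare lifts. *)
Lemma continuous_int_valued_const (R : realType) (h : R -> R) :
  continuous h -> (forall x, h x \is a Num.int) -> forall x y, h x = h y.
Proof.
move=> ch hint.
have aux x y : x <= y -> h x = h y.
  move=> xy; apply/eqP; apply: contraT => hxy.
  have [/intrP[k hx] /intrP[l hy]] := (hint x, hint y).
  have kl : k <> l by move=> e; rewrite hx hy e eqxx in hxy.
  have step (i j : int) : i < j -> i%:~R + 1 <= j%:~R :> R.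
    by move=> ij; rewrite -(intrD _ _ 1) ler_int; lia.
  have nohalf (i j : int) : i%:~R + 2^-1 = j%:~R :> R -> False.
    move=> e; have h1 : i%:~R < j%:~R :> R by lra.
    by rewrite ltr_int in h1; have := step i j h1; lra.
  have half v : Num.min (h x) (h y) <= v <= Num.max (h x) (h y) ->
      exists j : int, v = j%:~R.
    by move=> /(IVT xy (continuous_subspaceT ch))[z _ <-]; exact/intrP.
  have [lt_kl|lt_lk|//] := ltgtP k l.
    have := step k l lt_kl => kl1.
    have [|j /nohalf//] := half (k%:~R + 2^-1).
    by rewrite hx hy ge_min le_max; apply/andP; split; apply/orP; [left|right]; lra.
  have := step l k lt_lk => kl1.
  have [|j /nohalf//] := half (l%:~R + 2^-1).
  by rewrite hx hy ge_min le_max; apply/andP; split; apply/orP; [right|left]; lra.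
by move=> x y; have [/aux|/ltW/aux] := leP x y.
Qed.

(** * The lift of a multicritical circle map *)

Section Multicritical.
Variables (R : realType) (f : circle R -> circle R).
Hypothesis hf : multicritical f.
Hypothesis hper : no_periodic_points f.
Implicit Types (x y t u v : R) (z w : circle R).

Local Notation L := (circle_lift f).

(** Orientation preservation supplies a lift, so the choice in [circle_lift] does not fall back on
    its default value. *)
Lemma circle_lift_is_lift : is_lift f L.
Proof.
have [_ [F [FL _]] _ _] := hf.
exact: (xgetPex (idfun : R -> R) (ex_intro [set F | is_lift f F] F FL)).
Qed.

Let L_continuous : continuous L.
Proof. by case: circle_lift_is_lift. Qed.

Let L_proj x : circle_proj (L x) = f (circle_proj x).
Proof. by case: circle_lift_is_lift. Qed.

Lemma circle_lift_lt x y : x < y -> L x < L y.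
Proof.
have [_ [F [[cF Fproj] Flt]] _ _] := hf.
have H : forall x y, L x - F x = L y - F y.
  apply: (@continuous_int_valued_const R (fun t => L t - F t)).
    by move=> t; apply: cvgB; [exact: L_continuous|exact: cF].
  by move=> t; apply/circle_projP; rewrite L_proj Fproj.
by move=> xy; have := Flt _ _ xy; have := H x y; lra.
Qed.

(** The degree [m] is a positive integer by monotonicity. If it were at least 2, some [t] strictly
    between 0 and 1 would satisfy [L t = L 0 + 1], against the injectivity of [f]. *)
Lemma circle_lift_add1 x : L (x + 1) = L x + 1.
Proof.
have H : forall x y, L (x + 1) - L x = L (y + 1) - L y.
  apply: (@continuous_int_valued_const R (fun t => L (t + 1) - L t)).
    move=> t; apply: cvgB; last exact: L_continuous.
    apply: (@continuous_comp _ _ _ (fun t : R => t + 1)); last exact: L_continuous.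
    by apply: cvgD; [exact: cvg_id|exact: cvg_cst].
  move=> t; apply/circle_projP; rewrite !L_proj; congr f.
  exact: (circle_proj_addz t 1).
have /circle_proj_eq[m e] : circle_proj (L 1) = circle_proj (L 0).
  by rewrite !L_proj; congr f; rewrite -(circle_proj_addz 0 1) add0r.
have m0 : 0 < m%:~R :> R by have := @circle_lift_lt 0 1 ltr01; lra.
suff m1 : m = 1 by have := H x 0; rewrite add0r e m1; lra.
have [//|m2|/esym//] := ltgtP m 1; first by rewrite ltr0z in m0; lia.
have m2R : 2%:~R <= m%:~R :> R by rewrite ler_int; lia.
have hv : Num.min (L 0) (L 1) <= L 0 + 1 <= Num.max (L 0) (L 1).
  by rewrite ge_min le_max e; apply/andP; split; apply/orP; [left|right]; lra.
have [t t01 Lt] := IVT ler01 (continuous_subspaceT L_continuous) hv.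
rewrite in_itv/= in t01.
have t0 : 0 < t.
  rewrite lt_neqAle eq_sym; apply/andP; split; last by lra.
  by apply/eqP => t0; rewrite t0 in Lt; lra.
have t1 : t < 1.
  rewrite lt_neqAle; apply/andP; split; last by lra.
  by apply/eqP => t1; rewrite t1 e in Lt; lra.
have [[_ [g [_ fK _]]] _ _ _] := hf.
have : circle_proj t = circle_proj 0.
  apply: (can_inj fK); rewrite -!L_proj Lt.
  exact: (circle_proj_addz (L 0) 1).
move=> /circle_proj_eq[k]; rewrite add0r => tk.
have k0 : (0 : R) < k%:~R by rewrite -tk.
have k1 : k%:~R < 1%:~R :> R by rewrite -tk.
by rewrite ltr0z in k0; rewrite ltr_int in k1; lia.
Qed.

Local Notation D1 := (derive1n 1 L).
Local Notation D2 := (derive1n 2 L).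
Local Notation D3 := (derive1n 3 L).

Let dL n x : (n < 3)%N -> is_derive x 1 (derive1n n L) (derive1n n.+1 L x).
Proof.
move=> n3; have [_ _ [r [r3 [drv _]]] _] := hf.
have dn := drv n (leq_trans n3 r3) x.
by have := derivableP dn; rewrite /derive1n /= derive1E.
Qed.

Let D_addz n x (k : int) : (0 < n <= 3)%N ->
  derive1n n L (x + k%:~R) = derive1n n L x.
Proof.
have H1 y : D1 (y + k%:~R) = D1 y.
  apply: (@is_derive_periodic R L D1 k%:~R k%:~R); first exact: (fun t => @dL 0 t isT).
  by move=> t; have := iter_addz circle_lift_add1 1 t k.
have H2 y : D2 (y + k%:~R) = D2 y.
  by apply: (@is_derive_periodic R D1 D2 k%:~R 0);
    [exact: (fun t => @dL 1 t isT)|move=> t; rewrite H1 addr0].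
have H3 y : D3 (y + k%:~R) = D3 y.
  by apply: (@is_derive_periodic R D2 D3 k%:~R 0);
    [exact: (fun t => @dL 2 t isT)|move=> t; rewrite H2 addr0].
move=> n3; have : n = 1%N \/ n = 2%N \/ n = 3%N by lia.
by case=> [->|[->|->]]; [exact: H1|exact: H2|exact: H3].
Qed.

Lemma circle_deriv_proj n x : (0 < n <= 3)%N ->
  circle_deriv n f (circle_proj x) = derive1n n L x.
Proof.
by move=> n3; rewrite /circle_deriv; have [k ->] := circle_repr_proj x; rewrite D_addz.
Qed.

Lemma multicritical_critical_lift (b : R) :
  critical_lift (fun x => L x - b) D1 D2 D3.
Proof.
have [_ _ _ [N [c [W [N0 injc critE openW [HS HP _]]]]]] := hf.
have Dcrit x : D1 x = 0 -> exists i, circle_proj x = c i.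
  by move=> D0; apply/critE; rewrite /critical_point circle_deriv_proj.
split.
- move=> x; rewrite -[D1 x]subr0.
  exact: is_derive_sub (@dL 0 x isT) (is_derive_const x b).
- exact: (fun t => @dL 1 t isT).
- exact: (fun t => @dL 2 t isT).
- by move=> x y xy; rewrite ltrD2r circle_lift_lt.
- by move=> x; rewrite circle_lift_add1; ring.
- exists N, (fun i => repr (c i)) => x /Dcrit[i xc]; exists i.
  by apply/circle_projP; rewrite circle_reprK.
move=> t /Dcrit[i tc].
have [oW Wc] := openW i.
have : nbhs t (@circle_proj R @^-1` W i).
  apply: (@circle_proj_continuous R t); rewrite tc.
  by apply: open_nbhs_nbhs.
move=> /nbhs_ballP[d /= d0 Hd].
have [alpha [beta [s [a0 ab s1 Hs]]]] := HP i.
(* Below 1/2 the circle distance is the distance on the line, and [x] is no other lift of the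
   critical point. *)
have d1 : 0 < Num.min d 2^-1 by rewrite lt_min d0/=; lra.
exists (Num.min d 2^-1), alpha, beta, (s - 1).
split => //; [lra|lra|].
move=> x /andP[xt0]; rewrite lt_min => /andP[xtd xt2].
have Wx : W i (circle_proj x) by apply: Hd; rewrite /ball/= distrC.
have xc : circle_proj x <> c i.
  rewrite -tc => /circle_proj_eq[k xk].
  have e : x - t = k%:~R by rewrite xk; ring.
  rewrite e -intr_norm in xt0 xt2.
  have k1 : `|k|%:~R < 1%:~R :> R by lra.
  by rewrite ltr_int in k1; rewrite ltr0z in xt0; lia.
have [h1 h2] := Hs _ Wx xc; have h3 := HS i _ Wx xc.
rewrite -tc circle_dist_proj// circle_deriv_proj// in h1 h2.
by rewrite /schwarzian !circle_deriv_proj// in h3.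
Qed.

End Multicritical.

(** * Atoms of the dynamical partition as arcs *)

Section DynamicalPartition.
Variables (R : realType) (f : circle R -> circle R).
Hypothesis hf : multicritical f.
Hypothesis hper : no_periodic_points f.
Implicit Types (x y t u v c : R) (z w : circle R).

Local Notation rho := (rotation_number f).
Local Notation q := (return_time f).

Let L_lt := circle_lift_lt hf.
Let L_add1 := circle_lift_add1 hf.

(* The lift with translation number in [0, 1). *)
Definition reduced_lift x : R := circle_lift f x -
  (Num.floor (lim ((fun n : nat => iter n (circle_lift f) 0 / n%:R) @ \oo)))%:~R.
Local Notation F := reduced_lift.

Lemma iter_reduced_lift_proj n x :
  circle_proj (iter n F x) = iter n f (circle_proj x).
Proof.
elim: n => //= n <-; rewrite /F -rmorphN/= circle_proj_addz.
by have [_ ->] := circle_lift_is_lift hf.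
Qed.

Lemma reduced_lift_circle_lift_map : circle_lift_map F rho.
Proof.
have [tau ltau btau] := translation_number L_lt L_add1.
have limE := cvg_lim (@Rhausdorff R) ltau.
pose m := Num.floor tau.
have FE x : F x = circle_lift f x - m%:~R by rewrite /F limE.
have rhoE : rho = tau - m%:~R by rewrite /rotation_number limE.
have itE n x : iter n F x = iter n (circle_lift f) x - n%:R * m%:~R.
  elim: n => [|n IH]; first by rewrite mul0r subr0.
  rewrite /= IH FE -natr1 mulrDl mul1r.
  have -> : n%:R * m%:~R = (n%:Z * m)%:~R :> R by rewrite intrM.
  rewrite -!rmorphN/=.
  have := iter_addz L_add1 1 (iter n (circle_lift f) x) (- (n%:Z * m)).
  by rewrite /= => ->; rewrite !rmorphN/= ; ring.
split.
- by move=> x y xy; rewrite !FE ltrD2r L_lt.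
- by move=> x; rewrite !FE L_add1; ring.
- move=> x; apply: cvgB; last exact: cvg_cst.
  by have [cL _] := circle_lift_is_lift hf; exact: cL.
- move=> x n k n0 e; apply: (hper (x := circle_proj x) n0).
  by rewrite -iter_reduced_lift_proj e circle_proj_addz.
- move=> n; have := btau n; rewrite itE rhoE.
  have -> : iter n (circle_lift f) 0 - n%:R * m%:~R - n%:R * (tau - m%:~R) =
    iter n (circle_lift f) 0 - n%:R * tau by ring.
  by [].
Qed.

Let CF := reduced_lift_circle_lift_map.
Let FL : critical_lift F _ _ _ := multicritical_critical_lift hf _.
Let F_lt := clm_lt CF.
Let F_add1 := clm_add1 CF.

Lemma rotation_number_itv : 0 < rho < 1.
Proof.
have /andP[] := floor_itv (lim ((fun n : nat => iter n (circle_lift f) 0 / n%:R) @ \oo)).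
rewrite intrD1 => h1 h2.
have r0 : rho != 0.
  by have := @translation_irrational _ _ _ 1 0 CF isT; rewrite mul1r.
by apply/andP; split; [rewrite lt_def r0|]; rewrite /rotation_number /frac_part; lra.
Qed.

Let rho_gt0 : 0 < rho. Proof. by case/andP: rotation_number_itv. Qed.
Let rho_lt1 : rho < 1. Proof. by case/andP: rotation_number_itv. Qed.

Local Notation G := (closest_return F rho).
Local Notation D := (return_length F rho).

Lemma closest_return_proj n x : circle_proj (G n x) = iter (q n) f (circle_proj x).
Proof.
rewrite /closest_return /return_map -rmorphN/= circle_proj_addz.
exact: iter_reduced_lift_proj.
Qed.

(** The error at level [n.+2] is that at level [n] times a number strictly between 0 and 1, and
    displacements are ordered as the errors. *)
Lemma closest_return_SS n x :
  if odd n then G n x < G n.+2 x < x else x < G n.+2 x < G n x.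
Proof.
have := closest_return_ltE FL CF rho_gt0 rho_lt1 n.+2 x; rewrite /= negbK.
have irr m (k : int) (m0 : (0 < m)%N) := @translation_irrational _ _ _ m k CF m0.
have /andP[s0 _] := cf_error_sign rho_gt0 rho_lt1 irr n.
have e1 := cf_errorS rho_gt0 rho_lt1 irr n.
have e2 := cf_errorS rho_gt0 rho_lt1 irr n.+1.
have /andP[t0 t1] := gauss_iter_itv rho_gt0 rho_lt1 irr n.+1.
have /andP[t2 t3] := gauss_iter_itv rho_gt0 rho_lt1 irr n.+2.
pose t := iter n.+2 (@gauss R) rho * iter n.+1 (@gauss R) rho.
have tt : 0 < t < 1 by rewrite mulr_gt0//= mulr_ilt1// ltW.
have e : cf_error rho n.+2 = t * cf_error rho n by rewrite e2 e1 /t; ring.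
have [Phi [P DL]] := critical_lift_distortion FL CF.
rewrite -signr_odd in s0.
case: ifP => on h; rewrite on in s0.
  rewrite expr1 mulN1r in s0; rewrite h andbT.
  apply: (return_map_lt_translation DL).
  rewrite -!pmulrn -!/(cf_error rho _) e.
  have : 0 < (1 - t) * - cf_error rho n by rewrite mulr_gt0; lra.
  by lra.
rewrite expr0 mul1r in s0; rewrite h /=.
apply: (return_map_lt_translation DL).
rewrite -!pmulrn -!/(cf_error rho _) e.
have : 0 < (1 - t) * cf_error rho n by rewrite mulr_gt0; lra.
by lra.
Qed.

Definition return_arc n x := if odd n then arc (G n x) x else arc x (G n x).

(** By [closest_return_SS] the test in [dyn_interval] detects the parity: for odd [n] the positive
    arc from [c] to its return lifts to [c, G n c + 1] and misses the return at level [n.+2]. *)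
Lemma dyn_intervalE n c : dyn_interval f n (circle_proj c) = return_arc n c.
Proof.
rewrite /dyn_interval -!closest_return_proj /return_arc.
have := closest_return_SS n c.
have D1 := return_length_lt1 FL CF rho_gt0 rho_lt1 n c.
have DE := return_lengthE FL CF rho_gt0 rho_lt1 n c.
rewrite DE in D1; move: D1; case: ifP => on D1 h; last first.
  rewrite circle_arcE; [|lra|lra].
  by case: asboolP => // -[]; apply/in_arc; exists 0; lra.
have -> : circle_arc (circle_proj c) (circle_proj (G n c)) = arc c (G n c + 1).
  rewrite -(circle_proj_addz (G n c) 1) circle_arcE//; lra.
case: asboolP => [/in_arc[k hk]|_]; last by rewrite circle_arcE//; lra.
have k0 : 0 < k%:~R :> R by lra.
have k1 : 1 <= k%:~R :> R by move: k0; rewrite ltr0z gtz0_ge1 -(ler_int R).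
by exfalso; lra.
Qed.

Lemma image_arc i u v : u <= v ->
  iter i f @` arc u v = arc (iter i F u) (iter i F v).
Proof.
move=> uv; apply/seteqP; split=> z.
  move=> [_ [t /= tuv <-] <-]; rewrite -iter_reduced_lift_proj.
  rewrite in_itv/= in tuv; have /andP[ut tv] := tuv.
  by apply/in_arc; exists 0; rewrite addr0 !iter_le.
move=> [t /=]; rewrite in_itv/= => /andP[ut tv] <-.
have [s st] := clm_surjective CF i t.
exists (circle_proj s); last by rewrite -iter_reduced_lift_proj st.
apply/in_arc; exists 0; rewrite addr0; apply/andP; split.
  by rewrite leNgt; apply/negP => /(iter_lt F_lt i); rewrite st; lra.
by rewrite leNgt; apply/negP => /(iter_lt F_lt i); rewrite st; lra.
Qed.

Lemma image_dyn_interval i n c :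
  iter i f @` dyn_interval f n (circle_proj c) = return_arc n (iter i F c).
Proof.
have [Phi [P DL]] := critical_lift_distortion FL CF.
have := closest_return_ltE FL CF rho_gt0 rho_lt1 n c.
rewrite dyn_intervalE /return_arc /closest_return.
by case: ifP => _ /ltW h; rewrite image_arc// (return_map_iter DL).
Qed.

Lemma arc_length_return_arc n x : arc_length (return_arc n x) = D n x.
Proof.
have := closest_return_ltE FL CF rho_gt0 rho_lt1 n x.
have := return_length_lt1 FL CF rho_gt0 rho_lt1 n x.
rewrite (return_lengthE FL CF) // /return_arc.
by case: ifP => _ h1 h2; rewrite arc_length_arc//; lra.
Qed.

Lemma return_arc_endpoint n i c z : arc_endpoint (return_arc n (iter i F c)) z ->
  exists2 a, z = circle_proj (iter a F c) & a = i \/ a = (i + q n)%N.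
Proof.
have := return_length_lt1 FL CF rho_gt0 rho_lt1 n (iter i F c).
have E : circle_proj (G n (iter i F c)) = circle_proj (iter (i + q n) F c).
  by rewrite closest_return_proj !iter_reduced_lift_proj addnC iterD.
rewrite (return_lengthE FL CF) // /return_arc.
case: ifP => _ h /arc_endpointE[|->|->]; first by lra.
- by exists (i + q n)%N; [rewrite E|right].
- by exists i; [|left].
- by lra.
- by exists i; [|left].
- by exists (i + q n)%N; [rewrite E|right].
Qed.

Lemma orbit_injective c i j :
  circle_proj (iter i F c) = circle_proj (iter j F c) -> i = j.
Proof.
wlog ij : i j / (i <= j)%N.
  by move=> W; have [/W//|/ltnW/W H /esym/H/esym] := leqP i j.
rewrite !iter_reduced_lift_proj => e; apply/eqP; rewrite eqn_leq ij /=.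
rewrite leqNgt; apply/negP => lt_ij.
apply: (hper (x := iter i f (circle_proj c)) (n := (j - i)%N)).
  by rewrite subn_gt0.
by rewrite -iterD subnK.
Qed.

Lemma return_length_addz n x (k : int) : D n (x + k%:~R) = D n x.
Proof.
rewrite /return_length /closest_return /return_map.
by rewrite (iter_addz F_add1); congr `|_|; ring.
Qed.

Lemma return_length_iter n i c : D n (iter (i + q n) F c) = D n (G n (iter i F c)).
Proof.
by rewrite /closest_return /return_map -rmorphN/= return_length_addz addnC iterD.
Qed.

(** By aperiodicity the common end point is [iter a F c] for a single exponent [a]. Moving each
    atom's base point to it costs [C] at most, and changing the level there costs [C'], the only
    constant that depends on [c]. *)
Lemma adjacent_return_arcs : exists2 C, 1 <= C & forall c, derive1n 1 (circle_lift f) c = 0 ->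
  exists2 C', 1 <= C' &
  forall n i j m l, (m = n /\ (i < q n.+1)%N) \/ (m = n.+1 /\ (i < q n)%N) ->
    (l = n /\ (j < q n.+1)%N) \/ (l = n.+1 /\ (j < q n)%N) ->
    adjacent_atoms (return_arc m (iter i F c)) (return_arc l (iter j F c)) ->
    D m (iter i F c) <= C * C * C' * D l (iter j F c).
Proof.
have [C C1 HC] := return_length_geometry FL CF rho_gt0 rho_lt1.
exists C => // c /(critical_return_length FL CF rho_gt0 rho_lt1)[C' C'1 HC'].
exists C' => // n i j m l mi lj [z [/return_arc_endpoint[a za ai]]].
move=> /return_arc_endpoint[b zb bj].
have ab : a = b by apply: (orbit_injective (c := c)); rewrite -za -zb.
subst b.
have Dgt0 := return_length_gt0 FL CF rho_gt0 rho_lt1.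
have end_le m' i' : a = i' \/ a = (i' + q m')%N ->
    D m' (iter i' F c) <= C * D m' (iter a F c) /\
    D m' (iter a F c) <= C * D m' (iter i' F c).
  have D0 := Dgt0 m' (iter i' F c).
  move=> [->|->]; last by rewrite return_length_iter; exact: HC.
  by rewrite ler_peMl// ltW.
have [h1 _] := end_le m i ai; have [_ h2] := end_le l j bj.
suff mid : D m (iter a F c) <= C' * D l (iter a F c).
  apply: (le_trans h1).
  have -> : C * C * C' * D l (iter j F c) = C * (C' * (C * D l (iter j F c))) by ring.
  have C0 : 0 <= C by lra.
  have C'0 : 0 <= C' by lra.
  apply: ler_wpM2l => //; apply: (le_trans mid).
  by apply: ler_wpM2l.
have irr k (z : int) (k0 : (0 < k)%N) := @translation_irrational _ _ _ k z CF k0.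
have qq := cf_denom_leS rho_gt0 rho_lt1 irr n.
(* An end point occurs at a time below [q n + q n.+1], within reach of [critical_return_length]. *)
have aq : (a <= 2 * q n.+1)%N.
  have qS : (q n <= q n.+1)%N := qq.
  by case: mi ai => -[-> iq] [->|->]; lia.
have [h h'] := HC' n a aq.
have D0 := Dgt0 n (iter a F c); have D1 := Dgt0 n.+1 (iter a F c).
case: mi => -[-> _]; case: lj => -[-> _] //.
  by rewrite ler_peMl// ltW.
by rewrite ler_peMl// ltW.
Qed.

End DynamicalPartition.

Theorem theorem3p1 (R : realType) (f : circle R -> circle R)
  (hf : multicritical f) (hper : no_periodic_points f) :
  exists C : R, 1 < C /\
    forall c0 : circle R, critical_point f c0 ->
    forall (n : nat) (I J : set (circle R)),
      dyn_partition f n c0 I -> dyn_partition f n c0 J -> adjacent_atoms I J ->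
      C^-1 * arc_length J <= arc_length I /\ arc_length I <= C * arc_length J.
Proof.
have [C C1 HC] := adjacent_return_arcs hf hper.
have [_ _ _ [N [c [W [N0 injc critE _ _]]]]] := hf.
have crit i : derive1n 1 (circle_lift f) (repr (c i)) = 0.
  by have /critE : exists j, c i = c j by exists i.
(* Each of the finitely many critical points has its own constant; the sum dominates all of them. *)
pose wit i := cid2 (HC _ (crit i)); pose C' i := s2val (wit i).
have C'1 i : 1 <= C' i := s2valP (wit i).
pose S := \sum_i C' i.
have S_ge i : C' i <= S.
  rewrite /S (bigD1 i)//= lerDl; apply: sumr_ge0 => j _.
  by have := C'1 j; lra.
(* The added 1 makes the constant strictly larger than 1. *)
exists (C * C * S + 1).
have S1 : 1 <= S.
  by have := C'1 (Ordinal N0); have := S_ge (Ordinal N0); lra.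
have CC1 : 1 <= C * C by rewrite -[leLHS]mulr1 ler_pM.
have CCS : 1 <= C * C * S by rewrite -[leLHS]mulr1 ler_pM.
split; first by lra.
move=> c0 /critE[i0 ->] n I J PI PJ.
have HCi := s2valP' (wit i0); rewrite -/(C' i0) in HCi; have Si := S_ge i0.
have atom K : dyn_partition f n (c i0) K -> exists m i,
    ((m = n /\ (i < return_time f n.+1)%N) \/ (m = n.+1 /\ (i < return_time f n)%N)) /\
    K = return_arc f m (iter i (reduced_lift f) (repr (c i0))).
  rewrite -{1}(circle_reprK (c i0)) => -[] [i iq <-].
    by exists n, i; split; [left|exact: (image_dyn_interval hf hper)].
  by exists n.+1, i; split; [right|exact: (image_dyn_interval hf hper)].
have [m [i [mi ->]]] := atom I PI; have [l [j [lj ->]]] := atom J PJ.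
move=> adj; rewrite !arc_length_return_arc//.
have adj' : adjacent_atoms (return_arc f l (iter j (reduced_lift f) (repr (c i0))))
    (return_arc f m (iter i (reduced_lift f) (repr (c i0)))).
  by have [z [h1 h2]] := adj; exists z.
have h1 := HCi n i j m l mi lj adj; have h2 := HCi n j i l m lj mi adj'.
move: h1 h2.
set A := return_length _ _ m _; set B := return_length _ _ l _.
have A0 : 0 <= A by exact: normr_ge0.
have B0 : 0 <= B by exact: normr_ge0.
have CCi : C * C * C' i0 <= C * C * S + 1.
  have : C * C * C' i0 <= C * C * S by apply: ler_wpM2l => //; lra.
  lra.
move=> h1 h2; split; last by apply: (le_trans h1); exact: ler_wpM2r.
rewrite ler_pdivrMl; last by lra.
by apply: (le_trans h2); exact: ler_wpM2r.
Qed.
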